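(* Let $n\ge 0$ and $t\ge 0$ be integers, let $p$ be a prime, and let $j$ be an integer with $p\nmid j$. Then the following hold. (i) If $p\equiv 2\pmod 3$, then $$B_3^{(12)}\left(3p^{2t+2}n+\left(p^{2t+1}(p+3j)-1\right)\right)\equiv 0\pmod 3.$$ (ii) If $p\neq 3$ and $p\equiv 3\pmod 4$, then $$B_3^{(15)}\left(3p^{2t+2}n+\frac{p^{2t+1}(5p+12j)-5}{4}\right)\equiv 0\pmod 3.$$ (iii) If $p\neq 5$ and $p\equiv 2\pmod 3$, then $$B_5^{(10)}\left(5p^{2t+2}n+\frac{5\left(p^{2t+1}(p+3j)-1\right)}{3}\right)\equiv 0\pmod 5.$$ (iv) If $p\neq 7$ and $p\equiv 3\pmod 4$, then $$B_7^{(7)}\left(7p^{2t+2}n+\frac{7\left(p^{2t+1}(p+4j)-1\right)}{4}\right)\equiv 0\pmod 7.$$ (v) If $p\notin\{3,11\}$ and $p\equiv 3\pmod 4$, then $$B_{11}^{(11)}\left(11p^{2t+2}n+\frac{11\left(p^{2t+1}(5p+12j)-5\right)}{12}\right)\equiv 0\pmod{11}.$$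
   Context: For positive integers $\ell,r$ and an integer $n\ge 0$, $B_\ell^{(r)}(n)$ denotes the number of $\ell$-regular $r$-multipartitions of $n$, i.e. ordered $r$-tuples $(\lambda^{(1)},\dots,\lambda^{(r)})$ of (possibly empty) integer partitions, each having no part divisible by $\ell$, whose sizes sum to $n$; $B_\ell^{(r)}(0)=1$. Equivalently, as formal power series, $$\sum_{n=0}^\infty B_\ell^{(r)}(n)q^n=\frac{E_\ell^r}{E_1^r},\qquad E_k:=\prod_{m=1}^\infty(1-q^{km}).$$ By convention $B_\ell^{(r)}(m)=0$ for negative integers $m$. *)

(* Defs.v *)
From mathcomp Require Import all_boot all_order all_algebra.

Set Implicit Arguments.
Unset Strict Implicit.
Unset Printing Implicit Defensive.

Definition is_partition (s : seq nat) : bool := sorted geq s && (0 \notin s).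

Definition is_regular_partition (l : nat) (s : seq nat) : bool :=
  is_partition s && all (fun k => ~~ (l %| k)) s.

Definition is_regular_multipartition (l r n : nat) (f : r.-tuple (seq nat)) : bool :=
  all (is_regular_partition l) f && (\sum_(s <- f) sumn s == n).

(* The parts of a partition of an integer at most n, and their number, are at
   most n, so such a partition is a member of the finite type
   n.-bseq 'I_n.+1.  No multipartition is lost: see regular_multipartitionE. *)
Definition seq_of_bseq (n : nat) (s : n.-bseq 'I_n.+1) : seq nat := map val s.

Definition regular_multipartitions (l r n : nat) :
    {set r.-tuple (n.-bseq 'I_n.+1)} :=
  [set f | is_regular_multipartition l n (map_tuple (@seq_of_bseq n) f)].

Definition B (l r n : nat) : nat := #|regular_multipartitions l r n|.

Definition Bz (l r : nat) (m : int) : nat :=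
  match m with
  | Posz n => B l r n
  | Negz _ => 0
  end.

Lemma seq_of_bseq_inj n : injective (@seq_of_bseq n).
Proof. by move=> s1 s2 /(inj_map val_inj) /val_inj. Qed.

Lemma partition_bseq n s :
  is_partition s -> sumn s <= n -> exists b : n.-bseq 'I_n.+1, seq_of_bseq b = s.
Proof.
move=> /andP[_ s0] sn.
have hs : size s <= n.
  apply: leq_trans sn; elim: s s0 => //= k s IHs.
  rewrite inE negb_or => /andP[k0 /IHs]; rewrite -add1n => h.
  by rewrite leq_add // lt0n eq_sym.
have hk k : k \in s -> k <= n.
  move=> ks; apply: leq_trans sn; elim: s ks {s0 hs} => //= a s IHs.
  rewrite inE => /predU1P[->|/IHs h]; first exact: leq_addr.
  exact: leq_trans h (leq_addl _ _).
have hm : size (map (@inord n) s) <= n by rewrite size_map.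
exists (Bseq hm); rewrite /seq_of_bseq /= -map_comp -[RHS]map_id.
by apply/eq_in_map => k ks /=; rewrite inordK // ltnS hk.
Qed.

Lemma regular_multipartitionE l r n (f : r.-tuple (seq nat)) :
  is_regular_multipartition l n f =
  (f \in [seq map_tuple (@seq_of_bseq n) g | g in regular_multipartitions l r n]).
Proof.
apply/idP/imageP => [hf|[g]]; last by rewrite inE => hg ->.
have /andP[/allP hp /eqP hn] := hf.
have hb i : exists b : n.-bseq 'I_n.+1, seq_of_bseq b == tnth f i.
  have fi := mem_tnth i f; have /andP[hi _] := hp _ fi.
  have [|b <-] := partition_bseq (n := n) hi; last by exists b.
  by rewrite -hn (big_rem _ fi) /= leq_addr.
have E : f = map_tuple (@seq_of_bseq n) [tuple xchoose (hb i) | i < r].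
  apply: eq_from_tnth => i; rewrite tnth_map tnth_mktuple.
  by rewrite (eqP (xchooseP (hb i))).
by exists [tuple xchoose (hb i) | i < r]; rewrite // inE -E.
Qed.

Lemma B_count l r n (S : seq (r.-tuple (seq nat))) :
  uniq S -> (forall f, (f \in S) = is_regular_multipartition l n f) ->
  B l r n = size S.
Proof.
move=> uS hS; rewrite /B cardE -(size_map (map_tuple (@seq_of_bseq n))).
apply/perm_size/uniq_perm => // [|f]; last by rewrite hS regular_multipartitionE.
rewrite map_inj_uniq ?enum_uniq // => g h /(congr1 val) /= e.
exact/val_inj/(inj_map (@seq_of_bseq_inj n)).
Qed.

(* Main.v *)
Require Import Defs.
From mathcomp Require Import all_boot all_order all_algebra.
From mathcomp Require Import finfield zify ring.

(** For l prime, E_1^l = E_l modulo l, so that modulo l the series of B_l^(lk) is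
    E_l^((l-1)k): it suffices to locate the nonzero coefficients of E_1^6, E_1^8
    and E_1^10.  Jacobi's identity makes E_1^3 a sum over odd x of
    x q^((x^2-1)/8) with signs, hence E_1^6, E_1^9 and E_1^12 are signed sums over
    Z^2, Z^3 and Z^4.  In E_1^9 replace the weight xyz by (x-z)^2 (y-z), which
    differs from a multiple of it by terms even in some variable, and take u = x-z,
    v = y-z, w = x+y+z as coordinates: w runs over a class modulo 3 fixed by
    u and v, so Euler's pentagonal theorem makes the sum over w equal to 0 or to
    E_1 up to sign.  Cancelling E_1 leaves E_1^8 as a sum over the binary form
    u^2 - uv + v^2.  An orthogonal change of coordinates of Z^4, scaled by the
    square root of 3, similarly splits E_1^2 off E_1^12 and leaves E_1^10 as a sum
    over A^2 + B^2.  A prime inert for the form divides its values to an even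
    power, whereas in each congruence it would divide to an odd power. *)

Set Implicit Arguments.
Unset Strict Implicit.
Unset Printing Implicit Defensive.
Import Order.TTheory GRing.Theory Num.Theory.
Local Open Scope ring_scope.

(** * Truncated series, and the identities of Euler and Jacobi *)

Section Truncation.
Variables (R : comNzRingType) (M : nat).
Implicit Types p q : {poly R}.

(** Congruence modulo ['X^M]: infinite products and theta series are represented by polynomials that
    agree with them in low degree. *)
Definition eqX p q := forall i, (i < M)%N -> p`_i = q`_i.

Lemma eqX_refl p : eqX p p. Proof. by []. Qed.
Lemma eqX_eq p q : p = q -> eqX p q. Proof. by move->. Qed.
Lemma eqX_sym p q : eqX p q -> eqX q p.
Proof. by move=> h i /h ->. Qed.
Lemma eqX_trans p q r : eqX p q -> eqX q r -> eqX p r.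
Proof. by move=> h1 h2 i iM; rewrite h1 // h2. Qed.
Lemma eqXD p p' q q' : eqX p p' -> eqX q q' -> eqX (p + q) (p' + q').
Proof. by move=> h1 h2 i iM; rewrite !coefD h1 ?h2. Qed.
Lemma eqXN p p' : eqX p p' -> eqX (- p) (- p').
Proof. by move=> h i iM; rewrite !coefN h. Qed.
Lemma eqXM p p' q q' : eqX p p' -> eqX q q' -> eqX (p * q) (p' * q').
Proof.
move=> h1 h2 i iM; rewrite !coefM; apply: eq_bigr => j _.
by rewrite h1 ?h2 //; apply: leq_ltn_trans iM; rewrite ?leq_subr // -ltnS.
Qed.
Lemma eqXX p p' n : eqX p p' -> eqX (p ^+ n) (p' ^+ n).
Proof. by move=> h; elim: n => // n IH; rewrite !exprS; apply: eqXM. Qed.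
Lemma eqX_sum (I : Type) (r : seq I) (P : pred I) (F G : I -> {poly R}) :
  (forall i, P i -> eqX (F i) (G i)) ->
  eqX (\sum_(i <- r | P i) F i) (\sum_(i <- r | P i) G i).
Proof. by move=> h i iM; rewrite !coef_sum; apply: eq_bigr => j /h ->. Qed.
(** A constant coefficient 1 makes [p] a unit modulo ['X^M]. *)
Lemma eqX_cancel p q r : p`_0 = 1 -> eqX (p * q) (p * r) -> eqX q r.
Proof.
move=> p0 h; elim/ltn_ind => i IH iM.
have := h i iM; rewrite !coefM !big_ord_recl /= p0 !mul1r subn0.
rewrite [X in _ = _ + X](_ : _ = \sum_(j < i) p`_(bump 0 j) * q`_(i - bump 0 j)).
  by move/addIr.
by apply: eq_bigr => j _; rewrite IH //; have := ltn_ord j; rewrite /bump; lia.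
Qed.

Lemma eqX_mulXn p m : (M <= m)%N -> eqX (p * 'X^m) 0.
Proof.
by move=> mM i iM; rewrite coef0 coefMXn (leq_trans iM mM).
Qed.
End Truncation.

Lemma eqX_le (R : comNzRingType) M M' (p q : {poly R}) :
  (M' <= M)%N -> eqX M p q -> eqX M' p q.
Proof. by move=> MM h i iM; apply: h; apply: leq_trans iM MM. Qed.

Definition tri n := (n * n.+1)./2%N.

Arguments tri : simpl never.

Lemma tri0 : tri 0 = 0%N. Proof. by []. Qed.
Lemma triS n : tri n.+1 = (tri n + n.+1)%N.
Proof. rewrite /tri; lia. Qed.

Lemma tri_double n : (2 * tri n = n * n.+1)%N.
Proof. by elim: n => // n IH; rewrite triS; lia. Qed.

Lemma eqX_shift (R : comNzRingType) M m (p q : {poly R}) :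
  eqX M p q -> eqX (m + M) ('X^m * p) ('X^m * q).
Proof.
move=> h i iM; rewrite !coefXnM; case: ltnP => // mi; apply: h; lia.
Qed.

Section Qseries.
Variables (R : comNzRingType) (q : R).

Definition euler n : R := \prod_(i < n) (1 - q ^+ i.+1).

(* Shanks' finite form of the pentagonal number theorem. *)
Lemma euler_shanks n :
  \sum_(0 <= s < n.+1) (-1) ^+ s * (\prod_(s <= i < n) (1 - q ^+ i.+1))
      * q ^+ (s * n + tri s)
  = 1 + \sum_(0 <= k < n) (-1) ^+ k.+1 *
      (q ^+ (k.+1 * (3 * k.+1 + 1))./2 + q ^+ (k.+1 * (3 * k.+1 - 1))./2).
Proof.
elim: n => [|n IH].
  by rewrite big_nat1 !big_geq // tri0 expr0 !mulr1 addr0.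
rewrite big_nat_recr //= [in RHS]big_nat_recr //= addrA -IH {IH}.
rewrite [\prod_(n.+1 <= i < n.+1) _]big_geq // mulr1.
(* Passing from [n] to [n.+1] changes the summand at [s] by [V s.+1 - V s]. The changes telescope to
   [V n.+1], which together with the new summand at [s = n.+1] gives the two new pentagonal
   terms. *)
pose V s : R := if s is s'.+1
  then (-1) ^+ s * (\prod_(s' <= i < n) (1 - q ^+ i.+1)) * q ^+ (s * n + tri s)
  else 0.
have E : \sum_(0 <= s < n.+1) (-1) ^+ s *
     (\prod_(s <= i < n.+1) (1 - q ^+ i.+1)) * q ^+ (s * n.+1 + tri s) =
   \sum_(0 <= s < n.+1) (-1) ^+ s * (\prod_(s <= i < n) (1 - q ^+ i.+1))
      * q ^+ (s * n + tri s) + \sum_(0 <= s < n.+1) (V s.+1 - V s).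
  rewrite -big_split /=; apply: eq_big_nat => s /andP[_ sn].
  rewrite big_nat_recr //=.
  have -> : V s = (-1) ^+ s * (1 - q ^+ s) *
     (\prod_(s <= i < n) (1 - q ^+ i.+1)) * q ^+ (s * n + tri s).
    case: s sn => [|s] sn; first by rewrite /V expr0 subrr mulr0 !mul0r.
    by rewrite /V (big_ltn (m := s)) //=; ring.
  rewrite /V triS mulnS !mulSn !exprD !exprS; set pr := \prod_(_ <= _ < _) _.
  set x := (-1) ^+ s; set y := q ^+ tri s; set z := q ^+ (s * n).
  set u := q ^+ s; set v := q ^+ n; ring.
rewrite E telescope_sumr // /V subr0 big_geq // mulr1 -addrA; congr (_ + _).
rewrite -mulrDr addrC; congr (_ * (q ^+ _ + q ^+ _)); rewrite /tri; lia.
Qed.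

Lemma eulerS n : euler n.+1 = euler n * (1 - q ^+ n.+1).
Proof. by rewrite /euler big_ord_recr. Qed.

(** The Gaussian binomial coefficient, defined by a q-Pascal rule so that no division occurs. *)
Fixpoint qbin m k : R :=
  match m, k with
  | _, 0 => 1
  | 0, _.+1 => 0
  | m'.+1, k'.+1 => qbin m' k' + q ^+ k * qbin m' k
  end.

Arguments qbin : simpl never.

Lemma qbin0 m : qbin m 0 = 1. Proof. by case: m. Qed.

Lemma qbinS m k : qbin m.+1 k.+1 = qbin m k + q ^+ k.+1 * qbin m k.+1.
Proof. by []. Qed.

Lemma qbin_small m k : (m < k)%N -> qbin m k = 0.
Proof.
elim: m k => [|m IH] [|k] // mk; rewrite qbinS !IH ?mulr0 ?addr0 //.
by rewrite (leq_trans _ mk).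
Qed.

(** The other q-Pascal rule, obtained from the defining one by induction on [a + b]. *)
Lemma qbinS_alt a b :
  qbin (a + b).+1 a.+1 = qbin (a + b) a.+1 + q ^+ b * qbin (a + b) a.
Proof.
have [m] := ubnP (a + b)%N; elim: m a b => // m IH a b ab.
case: b ab => [|b] ab.
  by rewrite addn0 qbinS (qbin_small (leqnn _)) mulr0 addr0 expr0 mul1r add0r.
case: a ab => [|a] ab.
  have := IH 0 b; rewrite !add0n !qbin0 mulr1 => h.
  by rewrite (qbinS b.+1) {1}h ?(qbinS b) ?qbin0 ?exprSr; [ring | lia].
have := IH a b.+1; have := IH a.+1 b; rewrite !addSn !addnS.
set k := (a + b)%N => h1 h2.
rewrite (qbinS k.+2) {1}h1; last by lia.
rewrite {1}h2; last by lia.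
by rewrite (qbinS k.+1 a.+1) (qbinS k.+1 a) !exprS; ring.
Qed.

Lemma qbin_full m : qbin m m = 1.
Proof. by elim: m => // m IH; rewrite qbinS IH (qbin_small (leqnn _)) mulr0 addr0. Qed.

Lemma euler0 : euler 0 = 1.
Proof. by rewrite /euler big_ord0. Qed.

Lemma qbin_euler a b : qbin (a + b) a * (euler a * euler b) = euler (a + b).
Proof.
elim: a b => [|a IH] b; first by rewrite qbin0 euler0 !mul1r.
elim: b => [|b IHb]; first by rewrite addn0 qbin_full euler0 mulr1 mul1r.
rewrite addSn addnS qbinS mulrDl.
have h := IH b.+1; rewrite addnS in h.
rewrite addSn in IHb.
rewrite [in RHS]eulerS [X in X + _](_ : _ = euler (a + b).+1 * (1 - q ^+ a.+1)).
  rewrite [X in _ + X](_ : _ = euler (a + b).+1 * (1 - q ^+ b.+1) * q ^+ a.+1).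
    have -> : q ^+ (a + b).+2 = q ^+ a.+1 * q ^+ b.+1.
      by rewrite -exprD addSn addnS.
    by ring.
  by rewrite -IHb (eulerS b); ring.
by rewrite -h (eulerS a); ring.
Qed.

(* The natural number (k - a) (k - a - 1) / 2, where k may be less than a. *)
Definition jexp a k := if (a < k)%N then tri (k - a).-1 else tri (a - k).

Lemma jexpE a k : (2 * jexp a k)%:Z = (k%:Z - a%:Z) * (k%:Z - a%:Z - 1).
Proof.
rewrite /jexp; case: ltnP => h; rewrite tri_double.
  by rewrite -(subnKC h) addSnnS addKn /=; lia.
have -> : (k%:Z = a%:Z - (a - k)%:Z)%R by lia.
by move: (a - k)%N => d; lia.
Qed.

Definition jcoef a k := (-1) ^+ (a + k) * q ^+ jexp a k.

(* Finite form of Jacobi's triple product, multiplied by a monomial so that no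
   negative power of q or of the variable occurs. *)
Definition jprod a b : {poly R} :=
  (\prod_(i < a) ('X - (q ^+ i.+1)%:P)) * \prod_(i < b) (1 - q ^+ i *: 'X).

(** The case [a = 0] is the q-binomial theorem, by induction on [b] with [qbinS_alt]; each further
    factor of the first product is absorbed by [qbinS]. *)
Lemma coef_jprod a b k : (jprod a b)`_k = jcoef a k * qbin (a + b) k.
Proof.
elim: a b k => [|a IHa] b k.
  rewrite /jprod big_ord0 mul1r add0n.
  elim: b k => [|b IHb] k.
    rewrite big_ord0 coef1 /jcoef; case: k => [|k] /=; last by rewrite mulr0.
    by rewrite /jexp tri0 !mulr1.
  rewrite big_ord_recr /= mulrBr mulr1 -scalerAr coefB coefZ coefMX !IHb.
  case: k => [|k]; first by rewrite !qbin0 /= mulr0 subr0.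
  case: (leqP k b) => kb; last first.
    by rewrite !qbin_small ?mulr0 ?subr0 //; lia.
  have := qbinS_alt k (b - k); rewrite subnKC // => ->.
  rewrite mulrDr; congr (_ + _); rewrite /= /jcoef !add0n.
  have E : (b + jexp 0 k = jexp 0 k.+1 + (b - k))%N.
    by have := jexpE 0 k; have := jexpE 0 k.+1; lia.
  set Q := qbin b k.
  have -> : q ^+ b * ((-1) ^+ k * q ^+ jexp 0 k * Q) =
            (-1) ^+ k * q ^+ (b + jexp 0 k) * Q by rewrite exprD; ring.
  by rewrite E exprD exprS; ring.
rewrite /jprod big_ord_recr /= mulrAC -/(jprod a b) mulrBr coefB coefMX coefMC.
rewrite !IHa addSn; have E : (jexp a k + a.+1 = k + jexp a.+1 k)%N.
  by have := jexpE a k; have := jexpE a.+1 k; lia.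
have sgn : (-1) ^+ (a.+1 + k) = - (-1) ^+ (a + k) :> R.
  by rewrite addSn exprS mulN1r.
case: k E sgn => [|k] E sgn /=.
  by rewrite sub0r !qbin0 /jcoef sgn -[jexp a.+1 0]add0n -E (exprD q); ring.
rewrite qbinS mulrDr; congr (_ + _).
  have <- // : jcoef a k = jcoef a.+1 k.+1.
  by rewrite /jcoef addSn addnS !exprS mulrA mulrNN !mul1r.
rewrite /jcoef sgn; set Q := qbin _ _.
have -> : - (-1) ^+ (a + k.+1) * q ^+ jexp a.+1 k.+1 * (q ^+ k.+1 * Q) =
          - (-1) ^+ (a + k.+1) * q ^+ (k.+1 + jexp a.+1 k.+1) * Q.
  by rewrite [in RHS](exprD q); ring.
by rewrite -E (exprD q); ring.
Qed.

Lemma horner_deriv1 (p : {poly R}) n : (forall k, (n < k)%N -> p`_k = 0) ->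
  (p^`()).[1] = \sum_(k < n.+1) p`_k *+ k.
Proof.
move=> hp; rewrite (@horner_coef_wide _ n); last first.
  by apply/leq_sizeP => j nj; rewrite coef_deriv hp ?mul0rn.
rewrite big_ord_recl mulr0n add0r; apply: eq_bigr => i _.
by rewrite coef_deriv expr1n mulr1.
Qed.

(* The product vanishes at 1 because of the factor 1 - X; subtracting a multiple
   of its value there centres the weights k at the odd numbers 2k - 2n - 1. *)
Lemma jacobi_finite n :
  \sum_(k < n.+1.*2) (2 * k%:R - n.*2.+1%:R) * (jcoef n k * qbin n.*2.+1 k)
  = - 2 * euler n ^+ 2.
Proof.
have nn : (n + n.+1 = n.*2.+1)%N by lia.
have E k : (jprod n n.+1)`_k = jcoef n k * qbin n.*2.+1 k.
  by rewrite coef_jprod nn.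
have E0 k : (n.*2.+1 < k)%N -> (jprod n n.+1)`_k = 0.
  by move=> h; rewrite E qbin_small ?mulr0.
pose H : {poly R} := (\prod_(i < n) ('X - (q ^+ i.+1)%:P)) *
  \prod_(i < n) (1 - q ^+ i.+1 *: 'X).
have JH : jprod n n.+1 = (1 - 'X) * H.
  by rewrite /jprod /H [in LHS]big_ord_recl /= expr0 scale1r mulrCA.
have H1 : H.[1] = euler n ^+ 2.
  rewrite /H hornerM !horner_prod /euler expr2; congr (_ * _);
    by apply: eq_bigr => i _; rewrite !hornerE.
clearbody H.
have D1 : (jprod n n.+1)^`().[1] = - euler n ^+ 2.
  by rewrite JH derivM !hornerE !derivE !hornerE H1; ring.
have V1 : (jprod n n.+1).[1] = 0 by rewrite JH !hornerE subrr mul0r.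
rewrite (horner_deriv1 E0) in D1.
rewrite (@horner_coef_wide _ n.*2.+2) in V1; last by apply/leq_sizeP => j /E0.
transitivity (2 * \sum_(k < n.*2.+2) (jprod n n.+1)`_k *+ k -
  n.*2.+1%:R * \sum_(i < n.*2.+2) (jprod n n.+1)`_i * 1 ^+ i); last first.
  by rewrite D1 V1; ring.
rewrite !mulr_sumr -sumrB doubleS; apply: eq_bigr => k _.
by rewrite !E expr1n mulr1 -mulr_natr; ring.
Qed.

End Qseries.

Section Truncated.
Variables (R : comNzRingType) (d : nat).
Hypothesis d_gt0 : (0 < d)%N.
Local Notation eul := (@euler {poly R} 'X^d).

Lemma euler_const n : (eul n)`_0 = 1.
Proof.
elim: n => [|n IH]; first by rewrite euler0 coef1.
rewrite eulerS coefM big_ord1 IH mul1r coefB coef1 -exprM coefXn.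
by case: d d_gt0 => //= *; rewrite subr0.
Qed.

Lemma euler_stable c n : (c <= n)%N -> eqX (d * c.+1) (eul n) (eul c).
Proof.
elim: n => [|n IH]; first by rewrite leqn0 => /eqP->.
rewrite leq_eqVlt ltnS => /predU1P[->//|cn].
apply: eqX_trans (IH cn); rewrite eulerS mulrBr mulr1 -exprM.
rewrite -[X in eqX _ _ X]subr0; apply: eqXD => //; apply: eqXN.
by apply: eqX_mulXn; rewrite leq_mul2l ltnS cn orbT.
Qed.

(** The Gaussian binomial tends to the inverse of Euler's product as [a] and [b] both grow. *)
Lemma qbin_euler1 a b c n : (c <= a)%N -> (c <= b)%N -> (c <= n)%N ->
  eqX (d * c.+1) (qbin 'X^d (a + b) a * eul n) 1.
Proof.
move=> ca cb cn; apply: (@eqX_cancel _ _ (eul b)); first exact: euler_const.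
rewrite mulr1; apply: (@eqX_trans _ _ _ (eul (a + b))).
  rewrite -qbin_euler mulrCA [eul b * _]mulrC.
  apply: eqXM => //; apply: eqXM => //.
  by apply: eqX_trans (euler_stable cn) (eqX_sym (euler_stable ca)).
apply: eqX_trans (euler_stable _) (eqX_sym (euler_stable cb)).
exact: leq_trans ca (leq_addr _ _).
Qed.

(** One more factor [eul n] turns each Gaussian binomial of the finite identity into 1, up to high
    degree. *)
Lemma jacobi_trunc n :
  eqX (d * n.+1) (2 * eul n ^+ 3)
    (\sum_(k < n.+1.*2) (n.*2.+1%:R - 2 * k%:R) * jcoef 'X^d n k).
Proof.
have -> : 2 * eul n ^+ 3 = (- 2 * eul n ^+ 2) * - eul n by ring.
rewrite -jacobi_finite mulr_suml; apply: eqX_sum => k _.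
set w := _ - _; set Q := qbin _ _ _.
have -> : n.*2.+1%:R - 2 * k%:R = - w :> {poly R} by rewrite /w opprB.
have -> : w * (jcoef 'X^d n k * Q) * - eul n =
    - w * (jcoef 'X^d n k * (Q * eul n)).
  by ring.
apply: eqXM => //; rewrite /jcoef -[X in eqX _ _ X]mulr1 -!mulrA.
apply: eqXM => //; rewrite -exprM.
(* Near the ends of the range the binomial is accurate only to order [d * c.+1], but there the
   monomial makes up for the loss: [jexp n k + c >= n]. *)
pose c := minn k (n.*2.+1 - k).
have kn : (k < n.*2.+2)%N by rewrite -doubleS.
have : eqX (d * jexp n k + d * c.+1)
    ('X^(d * jexp n k) * (Q * eul n)) ('X^(d * jexp n k) * 1).
  apply: eqX_shift; rewrite /Q; have -> : n.*2.+1 = (k + (n.*2.+1 - k))%N.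
    by rewrite subnKC.
  apply: qbin_euler1; rewrite ?geq_minl ?geq_minr //; rewrite /c; lia.
apply: eqX_le; rewrite -mulnDr leq_mul2l; apply/orP; right.
have := jexpE n k; rewrite /c; nia.
Qed.

End Truncated.

(** * Theta sums over boxes of integers *)

Fixpoint zbox n : seq int :=
  if n is n'.+1 then [:: n%:Z, - n%:Z & zbox n'] else [:: 0].

Lemma mem_zbox n x : (x \in zbox n) = (`|x| <= n)%N.
Proof.
elim: n => [|n IH]; first by rewrite inE; lia.
by rewrite !inE IH; lia.
Qed.

Lemma zbox_uniq n : uniq (zbox n).
Proof.
elim: n => // n IH; rewrite [zbox _]/= !cons_uniq IH !inE !mem_zbox; lia.
Qed.

Lemma big_zbox (V : nmodType) n (F : int -> V) :
  \sum_(x <- zbox n) F x = F 0 + \sum_(0 <= k < n) (F k.+1%:Z + F (- k.+1%:Z)).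
Proof.
elim: n => [|n IH]; first by rewrite big_seq1 big_geq ?addr0.
rewrite big_nat_recr //= !big_cons IH [LHS]addrA [LHS]addrC [RHS]addrA.
reflexivity.
Qed.

Section Reindexing.
Variables (R : comNzRingType) (T U : eqType) (s : seq T) (t : seq U).
Variables (P : pred T) (Q : pred U) (a : T -> R) (b : U -> R).
Variables (f : T -> nat) (g : U -> nat) (phi : T -> U) (psi : U -> T) (M : nat).
Hypotheses (us : uniq s) (ut : uniq t).

(** The two maps need to be mutually inverse only on terms of exponent below [M]. Hence a linear
    change of variables can be used although it does not carry one box onto the other. *)
Lemma eqX_reindex :
  (forall v, v \in s -> P v -> (f v < M)%N ->
     [/\ phi v \in t, Q (phi v), psi (phi v) = v, g (phi v) = f v
       & b (phi v) = a v]) ->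
  (forall u, u \in t -> Q u -> (g u < M)%N ->
     [/\ psi u \in s, P (psi u), phi (psi u) = u & f (psi u) = g u]) ->
  eqX M (\sum_(v <- s | P v) a v *: 'X^(f v))
        (\sum_(u <- t | Q u) b u *: 'X^(g u)).
Proof.
move=> hs ht i iM; rewrite !coef_sum.
have red (W : eqType) (r : seq W) (C : pred W) (c : W -> R) (h : W -> nat) :
    \sum_(v <- r | C v) (c v *: 'X^(h v))`_i =
    \sum_(v <- [seq v <- r | C v && (h v == i)]) c v.
  rewrite big_filter big_mkcondr /=; apply: eq_bigr => v _.
  by rewrite coefZ coefXn eq_sym; case: eqP => _; rewrite ?mulr1 ?mulr0.
rewrite !red.
set s' := [seq _ <- s | _]; set t' := [seq _ <- t | _].
have hs' v : v \in s' -> [/\ v \in s, P v & f v = i].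
  by rewrite mem_filter => /andP[/andP[? /eqP ?] ?].
have ht' u : u \in t' -> [/\ u \in t, Q u & g u = i].
  by rewrite mem_filter => /andP[/andP[? /eqP ?] ?].
have pt : perm_eq [seq phi v | v <- s'] t'.
  apply: uniq_perm; rewrite ?filter_uniq //.
    rewrite map_inj_in_uniq ?filter_uniq // => v1 v2 /hs'[m1 p1 f1] /hs'[m2 p2 f2] e.
    have [|_ _ <- _ _] := hs _ m1 p1; rewrite ?f1 //.
    by have [|_ _ <- _ _] := hs _ m2 p2; rewrite ?f2 // e.
  move=> u; apply/mapP/idP => [[v /hs'[m p fv] ->]|/ht'[m q gu]].
    by have [|c1 c2 _ c3 _] := hs _ m p; rewrite ?fv // mem_filter c1 c2 c3 fv eqxx.
  have [|c1 c2 c3 c4] := ht _ m q; rewrite ?gu //.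
  by exists (psi u); rewrite ?c3 // mem_filter c1 c2 c4 gu eqxx.
rewrite -(perm_big _ pt) big_map /= big_seq [RHS]big_seq; apply: eq_bigr => v.
by move=> /hs'[m p fv]; have [|_ _ _ _ ->] := hs _ m p; rewrite ?fv.
Qed.
End Reindexing.

Lemma big_scale_support (R : pzRingType) (V : lmodType R) (I : Type)
    (s : seq I) (P C : pred I) (c : I -> R) (F : I -> V) :
  (forall w, ~~ C w -> c w = 0) ->
  \sum_(w <- s | P w) c w *: F w = \sum_(w <- s | P w && C w) c w *: F w.
Proof.
move=> h; rewrite big_mkcondr /=; apply: eq_bigr => w _.
by case: ifPn => // /h->; rewrite scale0r.
Qed.

(** The sum equals its own opposite, hence vanishes in characteristic 0. *)
Lemma big_antisym (R : numDomainType) (T : eqType) (s : seq T) (sg : T -> T)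
    (F : T -> {poly R}) :
  uniq s -> involutive sg -> (forall v, v \in s -> sg v \in s) ->
  (forall v, F (sg v) = - F v) -> \sum_(v <- s) F v = 0.
Proof.
move=> us sgK hs hF.
have pt : perm_eq [seq sg v | v <- s] s.
  apply: uniq_perm; rewrite ?map_inj_uniq //; first exact: inv_inj.
  move=> v; apply/mapP/idP => [[u /hs su ->] //|sv].
  by exists (sg v); rewrite ?sgK ?hs.
have E : \sum_(v <- s) F v = - \sum_(v <- s) F v.
  rewrite -{1}(perm_big _ pt) big_map -sumrN; apply: eq_bigr => v _; exact: hF.
apply/polyP => i; apply/eqP; rewrite coef0 -eqNr; apply/eqP.
by rewrite -coefN -E.
Qed.

(** [chi4] and [chi3] are the nontrivial Dirichlet characters modulo 4 and 3. The first carries the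
    signs of Euler's and Jacobi's series and restricts them to odd variables. *)
Definition chi4 (x : int) : int :=
  if (x %% 4)%Z == 1 then 1 else if (x %% 4)%Z == 3 then - 1 else 0.

Definition chi3 (x : int) : int :=
  if (x %% 3)%Z == 1 then 1 else if (x %% 3)%Z == 2 then - 1 else 0.

Lemma chi4N x : chi4 (- x) = - chi4 x.
Proof. by rewrite /chi4; repeat case: eqP => ?; lia. Qed.

Lemma chi4_neq0 x : (chi4 x != 0) = ~~ (2 %| x)%Z.
Proof. by rewrite /chi4; case: ifPn => ?; [|case: ifPn => ?]; lia. Qed.

Lemma chi4_odd (j : int) (n : nat) : (2 %| j - n%:Z)%Z ->
  chi4 (2 * j + 1) = (-1) ^+ n.
Proof. rewrite -signr_odd /chi4; case E : (odd n) => ? /=; rewrite ?expr0 ?expr1; repeat case: eqP => ?; lia. Qed.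

Definition nsq (x : int) : nat := absz (x * x).
Lemma nsqE x : (nsq x)%:Z = x * x. Proof. rewrite /nsq; nia. Qed.
Lemma leq_nsq x : (`|x| <= nsq x)%N. Proof. rewrite /nsq; nia. Qed.

Section Theta.
Variable M : nat.
Local Notation eul := (@euler {poly int} 'X^24 M).

(** Working in ['X^24] makes the exponents integral after completing squares: 24 k(3k+1)/2 + 1 =
    (6k+1)^2 for Euler's series, and 24 (x^2-1)/8 + 3 = 3x^2 for Jacobi's. *)
Definition pent_theta (s : int) : {poly int} :=
  \sum_(w <- zbox M | (3 %| w - s)%Z) chi4 w *: 'X^(nsq w).

Definition jac_theta : {poly int} :=
  \sum_(x <- zbox M) (chi4 x * x) *: 'X^(3 * nsq x).

Definition npent (k : int) : nat := (absz (k * (3 * k + 1)))./2.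
Lemma npentE k : (2 * npent k)%:Z = k * (3 * k + 1).
Proof.
have e : ~~ odd (absz (k * (3 * k + 1))).
  by rewrite abszM oddM; lia.
by rewrite /npent mul2n even_halfK //; nia.
Qed.

(** In Shanks' identity every summand with [s > 0] is divisible by q^(n+1), and the summand at
    [s = 0] is Euler's product. *)
Lemma euler_trunc d n :
  eqX (d * n.+1) (@euler {poly int} 'X^d n)
    (\sum_(k <- zbox n) (-1) ^+ `|k|%N * 'X^d ^+ npent k).
Proof.
have e : \sum_(k <- zbox n) (-1) ^+ `|k|%N * 'X^d ^+ npent k =
    1 + \sum_(0 <= k < n) (-1) ^+ k.+1 *
      ('X^d ^+ (k.+1 * (3 * k.+1 + 1))./2 + 'X^d ^+ (k.+1 * (3 * k.+1 - 1))./2)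
    :> {poly int}.
  rewrite big_zbox !expr0 mulr1; congr (_ + _); apply: eq_bigr => k _.
  rewrite abszN absz_nat -mulrDr; congr (_ * (_ ^+ _ + _ ^+ _));
    by rewrite /npent; congr _./2; nia.
rewrite e -euler_shanks big_nat_recl //= expr0 mul1r mul0n add0n tri0 expr0 mulr1.
rewrite big_mkord -/(euler _ n) -[X in eqX _ X]addr0; apply: eqXD => //.
apply: (@eqX_trans _ _ _ (\sum_(0 <= s < n) 0)); first by rewrite big1_eq.
apply: eqX_sum => s _.
apply: eqX_sym; rewrite -exprM; apply: eqX_mulXn.
rewrite leq_mul2l triS mulSn; apply/orP; right; lia.
Qed.

(** The odd integers congruent to 1 modulo 3 are the 6k+1, and [chi4] takes the value (-1)^k
    there. *)
Lemma pent_theta1 : eqX M (pent_theta 1) ('X * eul).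
Proof.
apply: eqX_sym; apply: (@eqX_trans _ _ _ (\sum_(k <- zbox M)
   ((-1) ^+ `|k|%N : int) *: 'X^((24 * npent k).+1))).
  apply: (@eqX_le _ (1 + 24 * M.+1)); first lia.
  have := eqX_shift (m := 1) (@euler_trunc 24 M); rewrite expr1 mulr_sumr => h.
  apply: eqX_trans h _; apply: eqX_sum => k _.
  rewrite -exprM exprS -mul_polyC rmorphXn rmorphN1 /=.
  by rewrite mulrCA.
rewrite /pent_theta.
rewrite [X in eqX _ _ X](@big_scale_support _ _ _ _ _ (fun w => chi4 w != 0)); last first.
  by move=> w /negPn/eqP.
apply: (eqX_reindex (phi := fun k => 6 * k + 1) (psi := fun w => ((w - 1) %/ 6)%Z)
  (zbox_uniq _) (zbox_uniq _)) => [k|w] _.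
- move=> _ km; have k2 := npentE k.
  have e : nsq (6 * k + 1) = (24 * npent k).+1 by have := nsqE (6 * k + 1); lia.
  have c : chi4 (6 * k + 1) = (-1) ^+ `|k|%N.
    rewrite -(@chi4_odd (3 * k) `|k|); last by lia.
    congr chi4; ring.
  split => //; rewrite ?e ?c //.
  + rewrite mem_zbox; apply: leq_trans (leq_nsq _) _; rewrite e; lia.
  + by rewrite -signr_odd; case: odd; rewrite andbT; lia.
  + lia.
- move=> /andP[w3 cw] wM.
  have ew : 6 * ((w - 1) %/ 6)%Z + 1 = w by move: cw; rewrite chi4_neq0; lia.
  move=> /=; move: ((w - 1) %/ 6)%Z ew => k ew.
  have nw : (nsq w)%:Z = (6 * k + 1) * (6 * k + 1) by rewrite nsqE ew.
  split => //; last by have := npentE k; lia.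
  by rewrite mem_zbox; have := leq_nsq w; lia.
Qed.

(** As [chi4] is odd, the reflection of w to -w cancels the class 0 modulo 3 and exchanges the other
    two classes with a change of sign. *)
Lemma pent_theta_chi3 s : pent_theta s = chi3 s *: pent_theta 1.
Proof.
have [h|h] : chi3 s = 0 /\ (3 %| s)%Z \/ chi3 s = 1 /\ (3 %| s - 1)%Z \/
  chi3 s = -1 /\ (3 %| s + 1)%Z by rewrite /chi3; repeat case: eqP => ?; lia.
- case: h => -> h; rewrite scale0r /pent_theta big_mkcond /=.
  apply: (big_antisym (sg := fun x => - x)); rewrite ?zbox_uniq //.
  + exact: opprK.
  + by move=> v; rewrite !mem_zbox abszN.
  + move=> v; rewrite chi4N /nsq mulrNN scaleNr.
    have -> : (3 %| - v - s)%Z = (3 %| v - s)%Z by lia.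
    by case: ifP; rewrite ?oppr0.
- case: h => -[-> h].
    by rewrite scale1r; apply: eq_bigl => w; lia.
  rewrite scaleN1r /pent_theta.
  have pt : perm_eq [seq - v | v <- zbox M] (zbox M).
    apply: uniq_perm; rewrite ?map_inj_uniq ?zbox_uniq //; first exact: oppr_inj.
    move=> v; apply/mapP/idP => [[u]|].
      by rewrite !mem_zbox => ? ->; rewrite abszN.
    by rewrite mem_zbox => ?; exists (- v); rewrite ?opprK // mem_zbox abszN.
  rewrite -{1}(perm_big _ pt) big_map -sumrN; apply: eq_big => [w|w _]; first lia.
  by rewrite chi4N /nsq mulrNN scaleNr.
Qed.

(** The substitution x = 2k - (2M+1) gives odd integers; x and -x contribute the same term, whence
    the factor 2. *)
Lemma jac_thetaE : eqX M jac_theta (2 * 'X^3 * eul ^+ 3).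
Proof.
apply: eqX_sym.
have h := eqX_shift (m := 3) (@jacobi_trunc int 24 isT M).
rewrite [2 * _]mulrC -mulrA; apply: eqX_trans (eqX_le _ h) _; first lia.
rewrite /jac_theta.
rewrite [X in eqX _ _ X](@big_scale_support _ _ _ _ _ (fun w => chi4 w != 0)); last first.
  by move=> w /negPn/eqP->; rewrite mul0r.
rewrite mulr_sumr -(big_mkord xpredT
  (fun k => 'X^3 * ((M.*2.+1%:R - 2 * k%:R) * jcoef 'X^24 M k))).
rewrite (eq_bigr (fun k : nat => ((M.*2.+1%:Z - 2 * k%:Z) * (-1) ^+ (M + k)) *:
   'X^(3 + 24 * jexp M k))); last first.
  move=> k _; rewrite /jcoef -exprM (exprD 'X) -mul_polyC !rmorphM rmorphB rmorphM.
  rewrite rmorphXn rmorphN1 /=.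
  rewrite -!natz !polyC_natr; ring.
apply: (eqX_reindex (phi := fun k => 2 * k%:Z - M.*2.+1%:Z)
  (psi := fun w => absz ((w + M.*2.+1%:Z) %/ 2)%Z)
  (iota_uniq _ _) (zbox_uniq _)) => [k|w].
- rewrite mem_iota subn0 => kM _ km; have k2 := jexpE M k.
  have e : (3 * nsq (2 * k%:Z - M.*2.+1%:Z) = 3 + 24 * jexp M k)%N.
    by have := nsqE (2 * k%:Z - M.*2.+1%:Z); lia.
  have c : chi4 (2 * k%:Z - M.*2.+1%:Z) = - (-1) ^+ (M + k).
    rewrite -[2 * _ - _]opprK chi4N -(@chi4_odd (M%:Z - k%:Z)); last by lia.
    congr (- chi4 _); lia.
  split => //; rewrite ?e ?c //.
  + rewrite mem_zbox; have := leq_nsq (2 * k%:Z - M.*2.+1%:Z); lia.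
  + by rewrite -signr_odd; case: odd.
  + lia.
  + ring.
- rewrite mem_zbox => wM cw gM.
  have ew : 2 * (absz ((w + M.*2.+1%:Z) %/ 2)%Z)%:Z - M.*2.+1%:Z = w.
    by move: cw; rewrite chi4_neq0; lia.
  have kM : (absz ((w + M.*2.+1%:Z) %/ 2)%Z < M.+1.*2)%N by lia.
  move=> /=; move: (absz ((w + M.*2.+1%:Z) %/ 2)%Z) ew kM => k ew kM.
  have nw : (nsq w)%:Z = (2 * k%:Z - M.*2.+1%:Z) * (2 * k%:Z - M.*2.+1%:Z).
    by rewrite nsqE ew.
  split => //; last by have := jexpE M k; lia.
  by change (k \in iota 0 M.+1.*2); rewrite mem_iota.
Qed.
End Theta.

(** * The A2 and B2 changes of variables *)

Section Pairs.
Variables (S T : eqType).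
Implicit Types (s : seq S) (t : seq T).

Definition seqX s t := [seq (x, y) | x <- s, y <- t].

Lemma mem_seqX s t v : (v \in seqX s t) = (v.1 \in s) && (v.2 \in t).
Proof.
apply/allpairsP/andP => [[p [? ? ->]] //|[? ?]].
by exists v; split => //; apply: surjective_pairing.
Qed.

Lemma seqX_uniq s t : uniq s -> uniq t -> uniq (seqX s t).
Proof. by move=> us ut; apply: allpairs_uniq => // -[? ?] [? ?]. Qed.

Lemma big_seqX_dep (V : nmodType) s t (Q : pred (S * T)) (F : S * T -> V) :
  \sum_(v <- seqX s t | Q v) F v =
  \sum_(x <- s) \sum_(y <- t | Q (x, y)) F (x, y).
Proof.
rewrite big_mkcond big_allpairs /=; apply: eq_bigr => x _.
by rewrite [RHS]big_mkcond.
Qed.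

Lemma big_seqX_mul (R : pzRingType) s t (P : pred S) (Q : pred T)
    (F : S -> R) (G : T -> R) :
  \sum_(v <- seqX s t | P v.1 && Q v.2) F v.1 * G v.2 =
  (\sum_(x <- s | P x) F x) * \sum_(y <- t | Q y) G y.
Proof.
rewrite big_seqX_dep mulr_suml [RHS]big_mkcond; apply: eq_bigr => x _ /=.
by case: (P x); rewrite ?big_pred0_eq // mulr_sumr.
Qed.
End Pairs.

Lemma nsqN x : nsq (- x) = nsq x. Proof. by rewrite /nsq mulrNN. Qed.

Lemma chi4_double1 i : chi4 (2 * i + 1) = if (2 %| i)%Z then 1 else -1.
Proof. by rewrite /chi4; case: ifPn => ?; [|case: ifPn => ?]; case: ifPn => ?; lia. Qed.

Lemma chi4_even i : (2 %| i)%Z -> chi4 i = 0.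
Proof. by move=> h; apply/eqP; rewrite -[_ == _]negbK chi4_neq0 h. Qed.

Lemma evenzD i j : (2 %| i + j)%Z = ((2 %| i)%Z == (2 %| j)%Z).
Proof. lia. Qed.
Lemma evenzN i : (2 %| - i)%Z = (2 %| i)%Z.
Proof. lia. Qed.

Lemma zparity x : (2 %| x)%Z \/ exists i, x = 2 * i + 1.
Proof.
have [h|h] := boolP (2 %| x)%Z; [by left|right; exists (x %/ 2)%Z; lia].
Qed.

(** Both sides vanish unless x, y, z are all odd: if the two differences are even and one variable
    is even, then all are, and so is the sum. For odd variables 2i+1, 2j+1, 2k+1 only the parities
    of i, j, k matter. *)
Lemma chi4_sum3 x y z : chi4 x * chi4 y * chi4 z =
  - chi4 (x + y + z) * (2 %| x - z)%Z%:Z * (2 %| y - z)%Z%:Z.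
Proof.
have [hx|[i ->]] := zparity x.
  rewrite (chi4_even hx) !mul0r; case hy: (2 %| y - z)%Z; last by rewrite mulr0.
  case hz: (2 %| x - z)%Z; rewrite ?mulr0 ?mul0r // chi4_even ?oppr0 ?mul0r //; lia.
have [hy|[j ->]] := zparity y.
  rewrite (chi4_even hy) !(mulr0, mul0r); case hyz: (2 %| y - z)%Z; last by rewrite mulr0.
  by rewrite [in X in _ * X * _](_ : (2 %| _)%Z = false) ?mulr0 ?mul0r //; lia.
have [hz|[k ->]] := zparity z.
  rewrite (chi4_even hz) !(mulr0, mul0r); case hyz: (2 %| _ - z)%Z; last by rewrite mulr0 mul0r.
  lia.
have -> : (2 %| 2 * i + 1 - (2 * k + 1))%Z by lia.
have -> : (2 %| 2 * j + 1 - (2 * k + 1))%Z by lia.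
have -> : 2 * i + 1 + (2 * j + 1) + (2 * k + 1) = 2 * (i + j + k + 1) + 1 by ring.
rewrite !chi4_double1 !evenzD; by do 3 case: (2 %| _)%Z.
Qed.

(** The four linear forms are given by a symmetric matrix of square 3, hence an involution modulo 2.
    So all four forms are odd exactly when a, b, c, d are, and then the signs are compared by
    parity. *)
Lemma chi4_sum4 a b c d : chi4 a * chi4 b * (chi4 c * chi4 d) =
  chi4 (a + c + d) * chi4 (b + c - d) * (chi4 (a + b - c) * chi4 (a - b - d)).
Proof.
have [odd4|] := boolP [&& ~~ (2 %| a), ~~ (2 %| b), ~~ (2 %| c) & ~~ (2 %| d)]%Z.
  case/and4P: odd4.
  have [->//|[i -> _]] := zparity a; have [->//|[j -> _]] := zparity b.
  have [->//|[k -> _]] := zparity c; have [->//|[l -> _]] := zparity d.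
  have -> : 2 * i + 1 + (2 * k + 1) + (2 * l + 1) = 2 * (i + k + l + 1) + 1 by ring.
  have -> : 2 * j + 1 + (2 * k + 1) - (2 * l + 1) = 2 * (j + k - l) + 1 by ring.
  have -> : 2 * i + 1 + (2 * j + 1) - (2 * k + 1) = 2 * (i + j - k) + 1 by ring.
  have -> : 2 * i + 1 - (2 * j + 1) - (2 * l + 1) = 2 * (i - j - l - 1) + 1 by ring.
  rewrite !chi4_double1 !evenzD !evenzN.
  by do 4 case: (2 %| _)%Z.
move=> h; transitivity (0 : int).
  have [/chi4_even->|ha] := boolP (2 %| a)%Z; first by rewrite !mul0r.
  have [/chi4_even->|hb] := boolP (2 %| b)%Z; first by rewrite mulr0 mul0r.
  have [/chi4_even->|hc] := boolP (2 %| c)%Z; first by rewrite !(mul0r, mulr0).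
  by rewrite (@chi4_even d) ?mulr0 //; move: h; rewrite ha hb hc /= negbK.
apply/esym.
have [/chi4_even->|ha] := boolP (2 %| a + c + d)%Z; first by rewrite !mul0r.
have [/chi4_even->|hb] := boolP (2 %| b + c - d)%Z; first by rewrite mulr0 mul0r.
have [/chi4_even->|hc] := boolP (2 %| a + b - c)%Z; first by rewrite !(mul0r, mulr0).
by rewrite (@chi4_even (a - b - d)) ?mulr0 //; lia.
Qed.

Section Macdonald.
Variable M : nat.
Local Notation Z := (zbox M).
Local Notation eul := (@euler {poly int} 'X^24 M).

Definition nA2 (p : int * int) : nat := absz (p.1 * p.1 - p.1 * p.2 + p.2 * p.2).
Lemma nA2E p : (nA2 p)%:Z = p.1 * p.1 - p.1 * p.2 + p.2 * p.2.
Proof. rewrite /nA2; nia. Qed.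

Lemma leq_nA2 p : (`|p.1| <= 2 * nA2 p)%N && (`|p.2| <= 2 * nA2 p)%N.
Proof.
have := nA2E p; have := leq_nsq p.1; have := leq_nsq p.2.
have := nsqE p.1; have := nsqE p.2; have := nsqE (p.1 - p.2); lia.
Qed.

(** [A2_theta] and [B2_theta] are what remains of the sums over Z^3 and Z^4 once the inner
    pentagonal sums are replaced by values of [chi3] and powers of Euler's product are split off. *)
Definition A2_theta : {poly int} :=
  \sum_(p <- seqX Z Z) ((2 %| p.1)%Z%:Z * (2 %| p.2)%Z%:Z * (p.1 ^+ 2 * p.2)
     * chi3 (p.1 + p.2)) *: 'X^(2 * nA2 p).

Definition B2_theta : {poly int} :=
  \sum_(p <- seqX Z Z) (chi4 p.1 * chi4 p.2 * (p.1 ^+ 3 * p.2)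
     * (chi3 (p.1 + p.2) * chi3 (p.1 - p.2))) *: 'X^(nsq p.1 + nsq p.2).

Definition A2_term (w : int -> int -> int -> int) (v : int * int * int) : {poly int} :=
  (chi4 v.1.1 * chi4 v.1.2 * chi4 v.2 * w v.1.1 v.1.2 v.2)
    *: 'X^(3 * (nsq v.1.1 + nsq v.1.2 + nsq v.2)).

(** Since [chi4] is odd, a monomial of even degree in some variable sums to zero. In the expansion
    of (x-z)^2 (y-z) only -2xyz survives. *)
Lemma A2_moment :
  \sum_(v <- seqX (seqX Z Z) Z) A2_term (fun x y z => (x - z) ^+ 2 * (y - z)) v =
  - 2 * jac_theta M ^+ 3.
Proof.
have uZ := zbox_uniq M.
(* The weight is split into a part even in y, a part even in x, and the surviving monomial. *)
rewrite (eq_bigr (fun v => A2_term (fun x y z => - ((x - z) ^+ 2 * z)) v +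
  (A2_term (fun x y z => y * (x ^+ 2 + z ^+ 2)) v +
   A2_term (fun x y z => - 2 * (x * y * z)) v))); last first.
  by move=> v _; rewrite /A2_term -!scalerDl; congr (_ *: _); ring.
rewrite !big_split /=.
rewrite (big_antisym (sg := fun v => (v.1.1, - v.1.2, v.2))); first last.
- by move=> [[x y] z]; rewrite /A2_term /= !nsqN !chi4N -scaleNr; congr (_ *: _); ring.
- by move=> [[x y] z]; rewrite !mem_seqX !mem_zbox abszN.
- by move=> [[x y] z] /=; rewrite opprK.
- by rewrite !seqX_uniq.
rewrite (big_antisym (sg := fun v => (- v.1.1, v.1.2, v.2))); first last.
- by move=> [[x y] z]; rewrite /A2_term /= !nsqN !chi4N -scaleNr; congr (_ *: _); ring.
- by move=> [[x y] z]; rewrite !mem_seqX !mem_zbox abszN.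
- by move=> [[x y] z] /=; rewrite opprK.
- by rewrite !seqX_uniq.
rewrite !add0r exprSr expr2 -!big_seqX_mul /=.
rewrite mulr_sumr; apply: eq_bigr => [[[x y] z]] _ /=.
rewrite /A2_term /= !mulnDr !exprD -!mul_polyC !(rmorphM, rmorphN, rmorph_nat) /=; ring.
Qed.

(** With u = x-z, v = y-z, w = x+y+z one has 3(x^2+y^2+z^2) = w^2 + 2(u^2-uv+v^2), and (u, v, w)
    comes from an integral point exactly when w is congruent to u+v modulo 3. *)
Lemma A2_change : eqX M
  (\sum_(v <- seqX (seqX Z Z) Z) A2_term (fun x y z => (x - z) ^+ 2 * (y - z)) v)
  (- (A2_theta * pent_theta M 1)).
Proof.
have uZ := zbox_uniq M.
have -> : - (A2_theta * pent_theta M 1) =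
   \sum_(u <- seqX (seqX Z Z) Z | (3 %| u.2 - (u.1.1 + u.1.2))%Z)
     (- chi4 u.2 * (2 %| u.1.1)%Z%:Z * (2 %| u.1.2)%Z%:Z * (u.1.1 ^+ 2 * u.1.2))
       *: 'X^(nsq u.2 + 2 * nA2 u.1).
  rewrite big_seqX_dep mulr_suml -sumrN; apply: eq_bigr => -[u v] _ /=.
  transitivity (- (((2 %| u)%Z%:Z * (2 %| v)%Z%:Z * (u ^+ 2 * v)) *:
    'X^(2 * nA2 (u, v)) * pent_theta M (u + v))).
    by rewrite (pent_theta_chi3 M (u + v)) -!mul_polyC !rmorphM /=; ring.
  rewrite mulr_sumr -sumrN; apply: eq_bigr => w _.
  by rewrite exprD -!mul_polyC !(rmorphM, rmorphN) /=; ring.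
rewrite /A2_term; apply: (@eqX_reindex _ _ _ _ _ xpredT _ _ _ _ _
  (fun v => (v.1.1 - v.2, v.1.2 - v.2, v.1.1 + v.1.2 + v.2))
  (fun u => let z := ((u.2 - (u.1.1 + u.1.2)) %/ 3)%Z in (z + u.1.1, z + u.1.2, z)));
  rewrite ?seqX_uniq //.
- move=> [[x y] z]; move: (x : int) (y : int) (z : int) => {}x {}y {}z _ _ /= fM.
  have e : (nsq (x + y + z)%R + 2 * nA2 (x - z, y - z)%R = 3 * (nsq x + nsq y + nsq z))%N.
    have := nA2E (x - z, y - z); have := nsqE x; have := nsqE y; have := nsqE z.
    have /= := nsqE (x + y + z); lia.
  split => //.
  + rewrite !mem_seqX !mem_zbox /=.
    have /= := leq_nA2 (x - z, y - z); have := leq_nsq (x + y + z).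
    move: (nsq (x + y + z)) (nA2 _) e => k l e. lia.
  + lia.
  + have -> : ((x + y + z - (x - z + (y - z))) %/ 3)%Z = z by lia.
    by congr (_, _, _); ring.
  + by rewrite chi4_sum3.
- move=> [[u v] w]; move: (u : int) (v : int) (w : int) => {}u {}v {}w _ /= h gM.
  have : 3 * ((w - (u + v)) %/ 3)%Z = w - (u + v) by lia.
  move: ((w - (u + v)) %/ 3)%Z => z ez.
  have ew : w = z + u + (z + v) + z by lia.
  have e : (3 * (nsq (z + u)%R + nsq (z + v)%R + nsq z) = nsq w + 2 * nA2 (u, v)%R)%N.
    have := nA2E (u, v); have := nsqE (z + u); have := nsqE (z + v); have := nsqE z.
    have /= := nsqE w; rewrite {2 3}ew; lia.
  split => //.
  + rewrite !mem_seqX !mem_zbox /=.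
    have := leq_nsq (z + u); have := leq_nsq (z + v); have := leq_nsq z; lia.
  + by rewrite -ew; congr (_, _, _); ring.
Qed.

Definition B2_term (w : int -> int -> int -> int -> int)
    (v : (int * int) * (int * int)) : {poly int} :=
  (chi4 v.1.1 * chi4 v.1.2 * (chi4 v.2.1 * chi4 v.2.2)
     * w v.1.1 v.1.2 v.2.1 v.2.2)
    *: 'X^(3 * (nsq v.1.1 + nsq v.1.2 + (nsq v.2.1 + nsq v.2.2))).

(** As in [A2_moment], only the monomial abcd survives; its coefficient 6 is the multinomial one of
    acd in (a+c+d)^3. The three other groups are even in b, a and c respectively. *)
Lemma B2_moment :
  \sum_(v <- seqX (seqX Z Z) (seqX Z Z))
     B2_term (fun a b c d => (a + c + d) ^+ 3 * (b + c - d)) v =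
  6 * jac_theta M ^+ 4.
Proof.
have uZ := zbox_uniq M.
rewrite (eq_bigr (fun v => B2_term (fun a b c d => (a + c + d) ^+ 3 * (c - d)) v +
  (B2_term (fun a b c d => b * ((c + d) ^+ 3 + 3 * a ^+ 2 * (c + d))) v +
  (B2_term (fun a b c d => b * (a ^+ 3 + 3 * a * (c ^+ 2 + d ^+ 2))) v +
   B2_term (fun a b c d => 6 * (a * b * (c * d))) v)))); last first.
  by move=> v _; rewrite /B2_term -!scalerDl; congr (_ *: _); ring.
rewrite !big_split /=.
rewrite (big_antisym (sg := fun v => ((v.1.1, - v.1.2), v.2))); first last.
- by move=> [[a b] [c d]]; rewrite /B2_term /= !nsqN !chi4N -scaleNr; congr (_ *: _); ring.
- by move=> [[a b] [c d]]; rewrite !mem_seqX !mem_zbox abszN.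
- by move=> [[a b] [c d]] /=; rewrite opprK.
- by rewrite !seqX_uniq.
rewrite (big_antisym (sg := fun v => ((- v.1.1, v.1.2), v.2))); first last.
- by move=> [[a b] [c d]]; rewrite /B2_term /= !nsqN !chi4N -scaleNr; congr (_ *: _); ring.
- by move=> [[a b] [c d]]; rewrite !mem_seqX !mem_zbox abszN.
- by move=> [[a b] [c d]] /=; rewrite opprK.
- by rewrite !seqX_uniq.
rewrite (big_antisym (sg := fun v => (v.1, (- v.2.1, v.2.2)))); first last.
- by move=> [[a b] [c d]]; rewrite /B2_term /= !nsqN !chi4N -scaleNr; congr (_ *: _); ring.
- by move=> [[a b] [c d]]; rewrite !mem_seqX !mem_zbox abszN.
- by move=> [[a b] [c d]] /=; rewrite opprK.
- by rewrite !seqX_uniq.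
rewrite !add0r (exprM _ 2 2) !expr2 -!big_seqX_mul /=.
rewrite mulr_sumr; apply: eq_bigr => [[[a b] [c d]]] _ /=.
rewrite /B2_term /= !mulnDr !exprD -!mul_polyC !(rmorphM, rmorph_nat) /=; ring.
Qed.

(** The new coordinates (A, B, C, D) multiply the sum of squares by 3. Integral points correspond to
    C = A+B and D = A-B modulo 3, so for fixed A and B the sum is a product of two pentagonal
    sums. *)
Lemma B2_change : eqX M
  (\sum_(v <- seqX (seqX Z Z) (seqX Z Z))
     B2_term (fun a b c d => (a + c + d) ^+ 3 * (b + c - d)) v)
  (B2_theta * pent_theta M 1 ^+ 2).
Proof.
have uZ := zbox_uniq M.
have -> : B2_theta * pent_theta M 1 ^+ 2 =
   \sum_(u <- seqX (seqX Z Z) (seqX Z Z) |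
       (3 %| u.2.1 - (u.1.1 + u.1.2))%Z && (3 %| u.2.2 - (u.1.1 - u.1.2))%Z)
     (chi4 u.1.1 * chi4 u.1.2 * (chi4 u.2.1 * chi4 u.2.2) * (u.1.1 ^+ 3 * u.1.2))
       *: 'X^(nsq u.1.1 + nsq u.1.2 + (nsq u.2.1 + nsq u.2.2)).
  rewrite big_seqX_dep mulr_suml; apply: eq_bigr => -[a b] _ /=.
  transitivity ((chi4 a * chi4 b * (a ^+ 3 * b)) *: 'X^(nsq a + nsq b) *
    (pent_theta M (a + b) * pent_theta M (a - b))).
    rewrite (pent_theta_chi3 M (a + b)) (pent_theta_chi3 M (a - b)).
    by rewrite -!mul_polyC !rmorphM /=; ring.
  rewrite -big_seqX_mul /= mulr_sumr; apply: eq_bigr => -[c d] _ /=.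
  by rewrite !exprD -!mul_polyC !rmorphM /=; ring.
rewrite /B2_term; apply: (@eqX_reindex _ _ _ _ _ xpredT _ _ _ _ _
  (fun v => ((v.1.1 + v.2.1 + v.2.2, v.1.2 + v.2.1 - v.2.2),
             (v.1.1 + v.1.2 - v.2.1, v.1.1 - v.1.2 - v.2.2)))
  (fun u => ((((u.1.1 + u.2.1 + u.2.2) %/ 3)%Z, ((u.1.2 + u.2.1 - u.2.2) %/ 3)%Z),
             (((u.1.1 + u.1.2 - u.2.1) %/ 3)%Z, ((u.1.1 - u.1.2 - u.2.2) %/ 3)%Z))));
  rewrite ?seqX_uniq //.
- move=> [[a b] [c d]]; move: (a : int) (b : int) (c : int) (d : int).
  move=> {}a {}b {}c {}d _ _ /= fM.
  have e : (nsq (a + c + d)%R + nsq (b + c - d)%R + (nsq (a + b - c)%R + nsq (a - b - d)%R)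
     = 3 * (nsq a + nsq b + (nsq c + nsq d)))%N.
    have := nsqE a; have := nsqE b; have := nsqE c; have := nsqE d.
    have := nsqE (a + c + d); have := nsqE (b + c - d).
    have := nsqE (a + b - c); have := nsqE (a - b - d); lia.
  split => //.
  + rewrite !mem_seqX !mem_zbox /=.
    have := leq_nsq (a + c + d); have := leq_nsq (b + c - d).
    have := leq_nsq (a + b - c); have := leq_nsq (a - b - d); lia.
  + lia.
  + by congr ((_, _), (_, _)); lia.
  + by rewrite (chi4_sum4 a b c d).
- move=> [[A B] [C D]]; move: (A : int) (B : int) (C : int) (D : int).
  move=> {}A {}B {}C {}D _ /= /andP[h1 h2] gM.
  have e1 : 3 * ((A + C + D) %/ 3)%Z = A + C + D by lia.
  have e2 : 3 * ((B + C - D) %/ 3)%Z = B + C - D by lia.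
  have e3 : 3 * ((A + B - C) %/ 3)%Z = A + B - C by lia.
  have e4 : 3 * ((A - B - D) %/ 3)%Z = A - B - D by lia.
  move: ((A + C + D) %/ 3)%Z ((B + C - D) %/ 3)%Z ((A + B - C) %/ 3)%Z
    ((A - B - D) %/ 3)%Z e1 e2 e3 e4.
  move=> a b c d e1 e2 e3 e4.
  have eA : A = a + c + d by lia.
  have eB : B = b + c - d by lia.
  have eC : C = a + b - c by lia.
  have eD : D = a - b - d by lia.
  have e : (3 * (nsq a + nsq b + (nsq c + nsq d)) =
      nsq A + nsq B + (nsq C + nsq D))%N.
    have := nsqE a; have := nsqE b; have := nsqE c; have := nsqE d.
    have := nsqE A; have := nsqE B; have := nsqE C; have := nsqE D.
    rewrite eA eB eC eD; lia.
  split => //.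
  + rewrite !mem_seqX !mem_zbox /=.
    have := leq_nsq a; have := leq_nsq b; have := leq_nsq c; have := leq_nsq d; lia.
  + by rewrite -eA -eB -eC -eD.
Qed.

Lemma jac_theta_sqr : jac_theta M ^+ 2 =
  \sum_(p <- seqX Z Z) (chi4 p.1 * p.1 * (chi4 p.2 * p.2))
    *: 'X^(3 * (nsq p.1 + nsq p.2)).
Proof.
rewrite expr2 -big_seqX_mul; apply: eq_bigr => -[x y] _ /=.
by rewrite mulnDr exprD -!mul_polyC !rmorphM /=; ring.
Qed.
End Macdonald.

(** * Exponents occurring in powers of Euler's product *)

Lemma euler_comp (R : comNzRingType) d n :
  @euler {poly R} 'X n \Po 'X^d = euler 'X^d n.
Proof.
rewrite /euler (rmorph_prod (comp_poly 'X^d)); apply: eq_bigr => i _ /=.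
by rewrite rmorphB rmorph1 /= rmorphXn /= comp_polyX.
Qed.

Lemma coef_euler_exp (R : comNzRingType) d n k N : (0 < d)%N ->
  (@euler {poly R} 'X^d n ^+ k)`_(d * N) = (@euler {poly R} 'X n ^+ k)`_N.
Proof.
move=> d0; rewrite -euler_comp -rmorphXn /= coef_comp_poly_Xn // dvdn_mulr //.
by rewrite mulKn.
Qed.

Lemma eqX_unshift (R : comNzRingType) M m (p q : {poly R}) :
  eqX (m + M) ('X^m * p) ('X^m * q) -> eqX M p q.
Proof.
move=> h i iM; have := h (m + i)%N; rewrite ltn_add2l => /(_ iM).
by rewrite !coefXnM ltnNge leq_addr /= addKn.
Qed.

Lemma coef_sumXn_neq0 (R : nzRingType) (I : Type) (s : seq I)
    (a : I -> R) (f : I -> nat) n :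
  (\sum_(v <- s) a v *: 'X^(f v))`_n != 0 -> exists v, a v != 0 /\ f v = n.
Proof.
elim: s => [|v s IH]; first by rewrite big_nil coef0 eqxx.
rewrite big_cons coefD coefZ coefXn.
have [an|an] := eqVneq (a v * (n == f v)%:R) 0; first by rewrite an add0r.
move=> _; exists v; move: an; case: (n =P f v) => [->|_]; last by rewrite mulr0 eqxx.
by rewrite mulr1.
Qed.

Section Supports.
Variables (M N : nat).
Local Notation eul := (@euler {poly int} 'X^24 M).
Local Notation E := (@euler {poly int} 'X M).

(** The coefficient at [N] appears in [jac_theta M ^+ 2] in degree 6 + 24N = 3(x^2+y^2). *)
Lemma euler6_support : (24 * N + 24 <= M)%N -> (E ^+ 6)`_N != 0 ->
  exists x y : int, 8 * N%:Z + 2 = x * x + y * y.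
Proof.
move=> NM; rewrite -(@coef_euler_exp _ 24) // => h.
have e6 : eqX M (\sum_(p <- seqX (zbox M) (zbox M))
    (chi4 p.1 * p.1 * (chi4 p.2 * p.2)) *: 'X^(3 * (nsq p.1 + nsq p.2)))
    ('X^6 * (4 * eul ^+ 6)).
  rewrite -jac_theta_sqr; apply: eqX_trans (eqXX 2 (@jac_thetaE M)) _.
  by apply: eqX_eq; ring.
have /coef_sumXn_neq0 : (\sum_(p <- seqX (zbox M) (zbox M))
    (chi4 p.1 * p.1 * (chi4 p.2 * p.2)) *: 'X^(3 * (nsq p.1 + nsq p.2)))`_(6 + 24 * N) != 0.
  rewrite e6; last by lia.
  by rewrite coefXnM ltnNge leq_addr /= addKn -polyC_natr coefCM mulf_neq0.
by move=> [[x y] [_ /= e]]; exists x, y; rewrite -!nsqE; lia.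
Qed.

(** After ['X * eul] is cancelled, the coefficient at [N] appears in [A2_theta M] in degree 8 + 24N
    = 2(u^2-uv+v^2) with u and v even; dividing by 8 gives the form in u/2 and v/2. *)
Lemma euler8_support : (24 * N + 24 <= M)%N -> (E ^+ 8)`_N != 0 ->
  exists i j : int, 3 * N%:Z + 1 = i * i - i * j + j * j.
Proof.
move=> NM; rewrite -(@coef_euler_exp _ 24) // => h.
have e8 : eqX M ('X^1 * (eul * A2_theta M)) ('X^1 * (eul * ('X^8 * (16 * eul ^+ 8)))).
  apply: eqX_trans (_ : eqX M _ (A2_theta M * pent_theta M 1)) _.
    by apply: eqX_sym; rewrite expr1 mulrA mulrC; apply: eqXM => //; exact: pent_theta1.
  rewrite -[A2_theta M * _]opprK; apply: eqX_trans (eqXN (eqX_sym (@A2_change M))) _.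
  rewrite A2_moment mulNr opprK.
  apply: eqX_trans (eqXM (@eqX_refl _ _ 2) (eqXX 3 (@jac_thetaE M))) _.
  by apply: eqX_eq; ring.
(* Cancelling the factor X costs one degree of precision. *)
have {}e8 : eqX M.-1 (A2_theta M) ('X^8 * (16 * eul ^+ 8)).
  apply: (eqX_cancel (@euler_const int 24 isT M)); apply: (@eqX_unshift _ _ 1).
  by apply: eqX_le e8; lia.
have /coef_sumXn_neq0 : (A2_theta M)`_(8 + 24 * N) != 0.
  rewrite e8; last by lia.
  by rewrite coefXnM ltnNge leq_addr /= addKn -polyC_natr coefCM mulf_neq0.
move=> [[u v] [/= c e]].
have eu : (2 %| u)%Z by apply: contraNT c => /negbTE->; rewrite !mul0r.
have ev : (2 %| v)%Z by apply: contraNT c => /negbTE->; rewrite mulr0 !mul0r.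
exists (u %/ 2)%Z, (v %/ 2)%Z; have /= := nA2E (u, v).
move: (nA2 _) e => q e.
have := divzK eu; have := divzK ev; move: (u %/ 2)%Z (v %/ 2)%Z => i j <- <-; lia.
Qed.

(** After [('X * eul) ^+ 2] is cancelled, the coefficient at [N] appears in [B2_theta M] in degree
    10 + 24N. The constant 96 is 6 times 2^4, the 2 coming from [jac_thetaE]. *)
Lemma euler10_support : (24 * N + 24 <= M)%N -> (E ^+ 10)`_N != 0 ->
  exists x y : int, 24 * N%:Z + 10 = x * x + y * y.
Proof.
move=> NM; rewrite -(@coef_euler_exp _ 24) // => h.
have e10 : eqX M ('X^2 * (eul ^+ 2 * B2_theta M))
    ('X^2 * (eul ^+ 2 * ('X^10 * (96 * eul ^+ 10)))).
  apply: eqX_trans (_ : eqX M _ (B2_theta M * pent_theta M 1 ^+ 2)) _.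
    have -> : 'X^2 * (eul ^+ 2 * B2_theta M) = B2_theta M * ('X * eul) ^+ 2 by ring.
    by apply: eqXM => //; apply: eqXX; apply: eqX_sym; exact: pent_theta1.
  apply: eqX_trans (eqX_sym (@B2_change M)) _; rewrite B2_moment.
  apply: eqX_trans (eqXM (@eqX_refl _ _ 6) (eqXX 4 (@jac_thetaE M))) _.
  by apply: eqX_eq; ring.
have {}e10 : eqX (M - 2) (B2_theta M) ('X^10 * (96 * eul ^+ 10)).
  apply: (@eqX_cancel _ _ (eul ^+ 2)).
    by rewrite expr2 coefM big_ord1 !euler_const ?mulr1.
  by apply: (@eqX_unshift _ _ 2); apply: eqX_le e10; lia.
have /coef_sumXn_neq0 : (B2_theta M)`_(10 + 24 * N) != 0.
  rewrite e10; last by lia.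
  by rewrite coefXnM ltnNge leq_addr /= addKn -polyC_natr coefCM mulf_neq0.
by move=> [[x y] [_ /= e]]; exists x, y; rewrite -!nsqE; lia.
Qed.
End Supports.

(** * Multipartitions modulo a prime *)

Section Enumeration.
Local Open Scope nat_scope.
Variable l : nat.

(* Recursion on the fuel m, which must be at least k + n. *)
Fixpoint regparts m k n : seq (seq nat) :=
  if m is m'.+1 then
    if k is k'.+1 then
      regparts m' k' n ++
      (if (k <= n) && ~~ (l %| k)
       then [seq k :: s | s <- regparts m' k (n - k)] else [::])
    else if n == 0 then [:: [::]] else [::]
  else if n == 0 then [:: [::]] else [::].

Definition regular_upto k n s :=
  [&& sorted geq s, all (fun x => (0 < x <= k) && ~~ (l %| x)) s & sumn s == n].

Lemma regular_upto0 n s : regular_upto 0 n s = (s == [::]) && (n == 0).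
Proof.
case: s => [|x s]; rewrite /regular_upto /= ?[0 == n]eq_sym //.
by rewrite [(0 < x <= 0)%N](_ : _ = false) ?andbF //; lia.
Qed.

(** Either no part equals k+1, or the largest part does and can be removed; this is the recursion of
    [regparts]. *)
Lemma regular_uptoS k n s : regular_upto k.+1 n s = regular_upto k n s ||
  (if s is x :: s'
   then [&& x == k.+1, k < n, ~~ (l %| k.+1) & regular_upto k.+1 (n - k.+1) s']
   else false).
Proof.
case: s => [|x s]; rewrite /regular_upto ?orbF //=.
have geq_trans : transitive geq by move=> a b c ab bc; apply: leq_trans bc ab.
rewrite !path_sortedE //.
have [->|xk] := eqVneq x k.+1.
  rewrite ltnn !andbF /= leqnn /=.
  have [hP|] := boolP (all (fun y => (0 < y <= k.+1) && ~~ (l %| y)) s); last first.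
    by rewrite !andbF.
  have -> : all (geq k.+1) s.
    by apply/allP => y /(allP hP) /andP[/andP[]].
  case: (l %| k.+1); case: (sorted geq s); rewrite ?andbF //=.
  by lia.
have [hx|] := boolP (all (geq x) s); last by rewrite !andFb orbF.
rewrite orbF /=; have [xk'|xk'] := leqP x k; last first.
  have -> : (x <= k.+1) = false by lia.
  by rewrite !andbF.
rewrite (leq_trans xk') //; congr [&& _, _ && _ & _].
apply: eq_in_all => y /(allP hx) /= yx.
by rewrite (leq_trans yx xk') (leq_trans yx) ?(leq_trans xk').
Qed.

Lemma mem_regparts m k n s : k + n <= m ->
  (s \in regparts m k n) = regular_upto k n s.
Proof.
have base s' j :
    (s' \in (if j == 0 then [:: [::]] else [::])) = regular_upto 0 j s'.
  by rewrite regular_upto0; case: (j == 0); rewrite ?andbF ?andbT // inE.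
elim: m k n s => [|m IH] [|k] n s kn; rewrite /= ?base //.
rewrite mem_cat regular_uptoS IH //; congr (_ || _).
case: s => [|x s]; first by case: ifP => // _; apply/negbTE/negP => -/mapP[].
have inj : injective (cons k.+1) by move=> ? ? [].
have [->|xk] := eqVneq x k.+1; last first.
  apply/negbTE/negP; case: ifP => // _ /mapP[s' _ [xk' _]].
  by rewrite xk' eqxx in xk.
have [kn'|//] := ltnP k n; case: (l %| k.+1) => //=.
by rewrite mem_map // IH //; lia.
Qed.

Lemma regparts_uniq m k n : k + n <= m -> uniq (regparts m k n).
Proof.
have base j : uniq (if j == 0 then [:: [::]] else [::] : seq (seq nat)).
  by case: eqP.
elim: m k n => [|m IH] [|k] n kn; rewrite /= ?base //.
rewrite cat_uniq IH //=; case: ifP => //= /andP[kn' _].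
rewrite map_inj_uniq ?IH ?andbT; [|by lia|by move=> ? ? []].
apply/hasPn => s /mapP[s' _ ->]; rewrite mem_regparts // /regular_upto /=.
by rewrite ltnn !andbF.
Qed.

Definition regcount k n := size (regparts (k + n) k n).

Lemma size_regparts m k n : k + n <= m -> size (regparts m k n) = regcount k n.
Proof.
move=> kn; apply/perm_size/uniq_perm; rewrite ?regparts_uniq // => s.
by rewrite !mem_regparts.
Qed.

Lemma regcount0 n : regcount 0 n = (n == 0).
Proof. by rewrite /regcount add0n; case: n. Qed.

Lemma regcountS k n : regcount k.+1 n = regcount k n +
  (if (k < n) && ~~ (l %| k.+1) then regcount k.+1 (n - k.+1) else 0).
Proof.
rewrite {1}/regcount addSn /= size_cat size_regparts //; congr (_ + _).
by case: ifP => // /andP[kn _]; rewrite size_map size_regparts //; lia.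
Qed.

Lemma mem_regparts_all k n s : n <= k ->
  (s \in regparts (k + n) k n) = is_regular_partition l s && (sumn s == n).
Proof.
move=> nk; rewrite mem_regparts // /regular_upto /is_regular_partition.
rewrite /is_partition -!andbA; case: (sorted geq s) => //=.
have [sn|] := eqVneq (sumn s) n; last by rewrite !andbF.
rewrite !andbT; have : sumn s <= k by rewrite sn.
elim: s {sn} => //= x s IH xk; rewrite IH ?inE ?negb_or; last by lia.
rewrite lt0n eq_sym (leq_trans (leq_addr _ _) xk) andbT -!andbA.
by congr (_ && _); rewrite andbCA.
Qed.

(** The bound [k] on the parts stays fixed along the recursion, so that the counts are convolutions
    of the single sequence [regcount k]; for [n <= k] it excludes nothing. *)
Fixpoint multis (k r n : nat) : seq (r.-tuple (seq nat)) :=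
  match r with
  | 0 => if n == 0 then [:: [tuple]] else [::]
  | r'.+1 =>
    [seq cons_tuple p.1 p.2 | a <- iota 0 n.+1,
       p <- seqX (regparts (k + a) k a) (multis k r' (n - a))]
  end.

Lemma mem_multis k r n (f : r.-tuple (seq nat)) : n <= k ->
  (f \in multis k r n) = is_regular_multipartition l n f.
Proof.
rewrite /is_regular_multipartition.
elim: r n f => [|r IH] n f nk.
  rewrite tuple0 big_nil /= [0 == n]eq_sym.
  by case: (n == 0); rewrite ?inE ?eqxx.
apply/allpairsPdep/idP => [[a [p [ha hp ->]]]|].
  move: hp ha; rewrite mem_seqX (mem_iota 0 n.+1) ltnS /= => /andP[h1 h2] an.
  move: h1 h2; rewrite mem_regparts_all ?(leq_trans an) // IH; last by lia.
  move=> /andP[-> /eqP s1] /andP[-> /eqP s2]; rewrite big_cons s1 s2; lia.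
case/tupleP: f => s f /=; rewrite big_cons -andbA => /and3P[hs hf /eqP sf].
exists (sumn s), (s, f); split=> //.
  by rewrite (mem_iota 0 n.+1); lia.
rewrite mem_seqX /= mem_regparts_all ?hs ?eqxx ?IH ?hf /=; try by lia.
Qed.

Lemma multis_uniq k r n : n <= k -> uniq (multis k r n).
Proof.
elim: r n => [|r IH] n nk /=; first by case: eqP.
apply: (@allpairs_uniq_dep nat
  (fun _ => (seq nat * r.-tuple (seq nat))%type : eqType) _
  (fun _ p => cons_tuple p.1 p.2) (iota 0 n.+1)); first by rewrite (iota_uniq 0 n.+1).
- move=> a; rewrite (mem_iota 0 n.+1) => an; apply: seqX_uniq; last by apply: IH; lia.
  by apply: regparts_uniq.
- move=> _ _ /allpairsPdep[a [p [ha hp ->]]] /allpairsPdep[b [q [hb hq ->]]] /=.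
  move: ha hb hp hq; rewrite !(mem_iota 0 n.+1) !mem_seqX => ha hb.
  case: p q => [s f] [s' f'] /= /andP[h1 _] /andP[h2 _] e.
  have es : s = s' by have := congr1 (@thead _ _) e; rewrite !theadE.
  have ef : f = f' by apply: val_inj; have := congr1 (fun t => behead (val t)) e.
  move: h1 h2; rewrite !mem_regparts_all; try by lia.
  rewrite -es => /andP[_ /eqP <-] /andP[_ /eqP <-]; by rewrite ef.
Qed.

Lemma B_multis k r n : n <= k -> B l r n = size (multis k r n).
Proof.
by move=> nk; apply: B_count => [|f]; [apply: multis_uniq | apply: mem_multis].
Qed.

Lemma size_multisS k r n : n <= k -> size (multis k r.+1 n) =
  \sum_(a < n.+1) regcount k a * size (multis k r (n - a)).
Proof.
move=> nk; rewrite /multis -/multis size_allpairs_dep sumnE big_map.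
rewrite -[n.+1]subn0 -/(index_iota 0 n.+1) big_mkord; apply: eq_bigr => a _.
by rewrite size_allpairs size_regparts.
Qed.

End Enumeration.

(** * Generating series of regular multipartitions and their reduction modulo l *)

Section GeneratingFunction.
Variables (R : comNzRingType) (l M : nat).

Definition reg_series k : {poly R} := \poly_(n < M) (regcount l k n)%:R.

Definition reg_euler k : {poly R} :=
  \prod_(i < k) (if (l %| i.+1)%N then 1 else 1 - 'X^(i.+1)).

(** Generating-function form of [regcountS]: multiplying by 1 - X^(k+1) discards the partitions with
    a part k+1. *)
Lemma reg_seriesS k : eqX M
  ((if (l %| k.+1)%N then 1 else 1 - 'X^(k.+1)) * reg_series k.+1) (reg_series k).
Proof.
move=> n nM; case: ifPn => h.
  by rewrite mul1r !coef_poly nM regcountS h andbF addn0.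
rewrite mulrBl mul1r coefB coefXnM !coef_poly nM regcountS h andbT.
case: (leqP n k) => [nk|kn].
  by rewrite ltnS nk addn0 subr0.
rewrite ltnS leqNgt kn natrD (leq_ltn_trans (leq_subr _ _) nM) /=; exact: addrK.
Qed.

Lemma reg_seriesE k : eqX M (reg_euler k * reg_series k) 1.
Proof.
elim: k => [|k IH].
  rewrite /reg_euler big_ord0 mul1r => n nM; rewrite coef_poly nM regcount0 coef1.
  by [].
apply: eqX_trans IH; rewrite /reg_euler big_ord_recr /=.
apply: eqX_trans (eqXM (@eqX_refl _ _ _) (@reg_seriesS k)).
by apply: eqX_eq; rewrite mulrA.
Qed.

Lemma B_series r : eqX M (\poly_(n < M) (B l r n)%:R) (reg_series M ^+ r).
Proof.
have nM n : (n < M)%N -> (n <= M)%N by apply: ltnW.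
elim: r => [|r IH] n hn; rewrite coef_poly hn (B_multis _ _ (nM _ hn)).
  by rewrite expr0 coef1 /=; case: (n == 0%N).
rewrite (size_multisS _ _ (nM _ hn)) exprS coefM natr_sum; apply: eq_bigr => a _.
have an := ltn_ord a; rewrite ltnS in an.
have aM := leq_ltn_trans an hn; have bM := leq_ltn_trans (leq_subr a n) hn.
rewrite -(IH _ bM) !coef_poly aM bM natrM (B_multis _ _ (nM _ bM)) //.
Qed.

(** The factors of index divisible by l form Euler's product in ['X^l] with [M %/ l] factors;
    extending it to [M] factors changes nothing in degrees below [M]. *)
Lemma reg_euler_split : (0 < l)%N ->
  eqX M (reg_euler M * euler 'X^l M) (euler 'X M).
Proof.
move=> l0.
have -> : @euler {poly R} 'X M = reg_euler M * euler 'X^l (M %/ l).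
  rewrite /reg_euler; elim: M => [|m IH]; first by rewrite div0n !euler0 big_ord0 mulr1.
  rewrite eulerS IH big_ord_recr /= divnS //.
  have := divnK (d := l) (m := m.+1); rewrite divnS //.
  case: (l %| m.+1)%N => [/(_ isT)|_]; last by rewrite add0n mulrAC.
  by rewrite add1n mulnC eulerS -exprM => ->; rewrite mulr1 mulrA.
apply: eqXM => //; apply: eqX_le (@euler_stable R l _ _ (leq_div M l)).
by rewrite ltnW // mulnC -ltn_divLR.
Qed.

End GeneratingFunction.

Lemma euler_frobenius l n : prime l ->
  @euler {poly 'F_l} 'X n ^+ l = euler 'X^l n.
Proof.
move=> lp; rewrite /euler -prodrXl; apply: eq_bigr => i _.
have ch : l \in [pchar {poly 'F_l}] by rewrite pchar_poly pchar_Fp.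
rewrite -(pFrobenius_autE ch) pFrobenius_autB_comm; last exact: commr_sym (commr1 _).
by rewrite !pFrobenius_autE expr1n -!exprM mulnC.
Qed.

Lemma euler_map (R : comNzRingType) n :
  map_poly intr (@euler {poly int} 'X n) = @euler {poly R} 'X n.
Proof.
rewrite /euler rmorph_prod; apply: eq_bigr => i _ /=.
by rewrite rmorphB rmorph1 /= map_polyXn.
Qed.

(** Over ['F_l] the series E_l^(lk) / E_1^(lk) equals E_l^((l-1)k), a series in X^l: its
    coefficients vanish off the multiples of l, and at lN it has the coefficient of E_1^((l-1)k) at
    N. *)
Lemma B_mod (l k m M : nat) : prime l -> (m < M)%N ->
  (forall N, m = (l * N)%N -> (@euler {poly int} 'X M ^+ (l.-1 * k))`_N = 0) ->
  (l %| B l (l * k) m)%N.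
Proof.
move=> lp mM h; have l0 := prime_gt0 lp.
have E1 : eqX M (\poly_(n < M) (B l (l * k) n)%:R)
    (@euler {poly 'F_l} 'X^l M ^+ (l.-1 * k)).
  apply: (@eqX_cancel _ _ (euler 'X^l M ^+ k)).
    elim: k {h} => [|k IH]; first by rewrite coef1.
    by rewrite exprS coefM big_ord1 IH euler_const ?mulr1.
  rewrite -exprD -mulSn prednK //.
  rewrite -{1}euler_frobenius // -exprM.
  have S1 := eqX_sym (eqXX (l * k) (@reg_euler_split 'F_l l M l0)).
  apply: eqX_trans (eqXM S1 (@B_series 'F_l l M (l * k))) _.
  rewrite exprMn mulrAC -exprMn -[X in eqX _ _ X]mul1r.
  apply: eqXM => //; rewrite -(expr1n _ (l * k)); apply: eqXX.
  exact: reg_seriesE.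
rewrite (dvdn_pcharf (pchar_Fp lp)).
have := E1 m mM; rewrite coef_poly mM => ->.
have [/dvdnP[N mN]|lm] := boolP (l %| m)%N.
  rewrite mulnC in mN; rewrite mN coef_euler_exp // -euler_map -rmorphXn /=.
  by rewrite coef_map /= h ?rmorph0.
by rewrite -euler_comp -rmorphXn /= coef_comp_poly_Xn // (negbTE lm).
Qed.

(** * Descent *)

Section Descent.
Variables (p : nat) (p_prime : prime p).

Lemma dvdz_Fp (x : int) : (p %| x)%Z = (x%:~R == 0 :> 'F_p).
Proof.
rewrite dvdzE absz_nat; case: x => n.
  by rewrite absz_nat (dvdn_pcharf (pchar_Fp p_prime)).
by rewrite NegzE abszN absz_nat rmorphN oppr_eq0 (dvdn_pcharf (pchar_Fp p_prime)).
Qed.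

Lemma Fp_fermat (z : 'F_p) : z != 0 -> z ^+ p.-1 = 1.
Proof.
move=> z0; apply: (mulfI z0); rewrite mulr1 -exprS prednK ?prime_gt0 //.
by have := expf_card z; rewrite card_Fp.
Qed.

(** Otherwise x/y is a square root of -1 in ['F_p]; as (p-1)/2 is odd, Fermat's theorem gives -1 =
    1, so that p divides 2. *)
Lemma dvdz_sum_sqr (x y : int) : p = 3 %[mod 4] ->
  (p %| x * x + y * y)%Z -> (p %| x)%Z /\ (p %| y)%Z.
Proof.
move=> p4; rewrite !dvdz_Fp rmorphD !rmorphM /=.
move: (x%:~R : 'F_p) (y%:~R : 'F_p) => {}x {}y /eqP e.
have y0 : y = 0.
  apply/eqP/negP => /negP y0.
  have e2 : (x / y) ^+ 2 = - 1.
    rewrite expr_div_n !expr2 -[x * x](addrK (y * y)) e sub0r mulNr divff //.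
    by rewrite mulf_neq0.
  have z0 : x / y != 0.
    by apply: contra_eq_neq e2 => ->; rewrite expr0n eq_sym oppr_eq0 oner_eq0.
  have := Fp_fermat z0; have -> : p.-1 = (2 * (2 * (p %/ 4)).+1)%N.
    have := divn_eq p 4; rewrite p4; lia.
  rewrite exprM e2 exprS exprM sqrrN expr1n expr1n mulr1 => /eqP.
  rewrite eq_sym -addr_eq0 -[1 + 1]/(2%:R) -(dvdn_pcharf (pchar_Fp p_prime)).
  by move=> /dvdn_leq; have := prime_gt1 p_prime; lia.
by move: e; rewrite y0 mulr0 addr0 => /eqP; rewrite mulf_eq0 orbb => ->.
Qed.

(** Otherwise -x/y is a cube root of unity in ['F_p]; as p-1 is 1 modulo 3, Fermat's theorem makes
    it 1. Then x = -y and the form is 3y^2, which forces p = 3. *)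
Lemma dvdz_norm3 (x y : int) : p = 2 %[mod 3] ->
  (p %| x * x - x * y + y * y)%Z -> (p %| x)%Z /\ (p %| y)%Z.
Proof.
move=> p3; rewrite !dvdz_Fp rmorphD rmorphB !rmorphM /=.
move: (x%:~R : 'F_p) (y%:~R : 'F_p) => {}x {}y /eqP e.
have y0 : y = 0.
  apply/eqP/negP => /negP y0.
  have e3 : (- (x / y)) ^+ 3 = 1.
    have : x ^+ 3 + y ^+ 3 = 0.
      have -> : x ^+ 3 + y ^+ 3 = (x + y) * (x * x - x * y + y * y) by ring.
      by rewrite e mulr0.
    move=> /eqP; rewrite addrC addr_eq0 => /eqP ey.
    by rewrite -mulNr expr_div_n exprNn -signr_odd /= expr1 mulN1r -ey divff // expf_neq0.
  have z0 : - (x / y) != 0.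
    by apply: contra_eq_neq e3 => ->; rewrite expr0n eq_sym oner_eq0.
  have := Fp_fermat z0; have -> : p.-1 = (3 * (p %/ 3)).+1%N.
    have := divn_eq p 3; rewrite p3; lia.
  rewrite exprS exprM e3 expr1n mulr1 => /eqP; rewrite eqr_oppLR => /eqP ex.
  have {}ex : x = - y by rewrite -[x](divfK y0) ex mulN1r.
  have /eqP : 3%:R * (y * y) = 0 :> 'F_p by rewrite -e ex; ring.
  rewrite !mulf_eq0 (negbTE y0) orbb orbF -(dvdn_pcharf (pchar_Fp p_prime)).
  by rewrite dvdn_prime2 // => /eqP p3'; move: p3; rewrite p3'.
by move: e; rewrite y0 !mulr0 subr0 addr0 => /eqP; rewrite mulf_eq0 orbb => ->.
Qed.

(** Each descent step divides x and y by p and removes p^2 from the right-hand side; in the end p u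
    is divisible by p^2. *)
Lemma odd_valuation (Q : int -> int -> int) (t : nat) (x y u : int) :
  (forall x y, (p %| Q x y)%Z -> (p %| x)%Z /\ (p %| y)%Z) ->
  (forall c x y, Q (x * c) (y * c) = c * c * Q x y) ->
  Q x y = p%:Z ^+ (2 * t + 1) * u -> (p %| u)%Z.
Proof.
move=> anis homog; have p0 : p%:Z != 0 by have := prime_gt0 p_prime; lia.
elim: t x y => [|t IH] x y e.
  have [] : (p %| x)%Z /\ (p %| y)%Z.
    by apply: anis; rewrite e muln0 add0n expr1 dvdz_mulr.
  move=> /dvdzP[x' ex] /dvdzP[y' ey]; move: e; rewrite ex ey homog -mulrA.
  by rewrite muln0 add0n expr1 => /(mulfI p0) <-; apply: dvdz_mulr.
have [] : (p %| x)%Z /\ (p %| y)%Z.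
  by apply: anis; rewrite e addn1 exprS -mulrA dvdz_mulr.
move=> /dvdzP[x' ex] /dvdzP[y' ey]; apply: (IH x' y').
move: e; rewrite ex ey homog -!mulrA mulnS -addnA exprD -mulrA expr2 -mulrA.
by move=> /(mulfI p0) /(mulfI p0).
Qed.

Lemma dvdz_coef (c : nat) (a j : int) : ~~ (p %| j)%Z ->
  (p %| a * p%:Z + c%:Z * j)%Z -> (p %| c)%N.
Proof.
move=> hj; rewrite rpredDl => [h|]; last exact: dvdz_mull.
by move: h; rewrite dvdzE abszM Euclid_dvdM // => /orP[//|h]; rewrite dvdzE h in hj.
Qed.

(** Since p^2 is 1 modulo d, so is p^(2t+2); this makes the divisions in the arguments of B
    exact. *)
Lemma sqr_pow_mod (d c : int) t : p%:Z * p%:Z = d * c + 1 ->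
  exists w, p%:Z ^+ (2 * t + 1) * p%:Z = d * w + 1.
Proof.
move=> e; elim: t => [|t [w IH]]; first by exists c; rewrite expr1.
exists (w * d * c + w + c); rewrite mulnS -addnA exprD -mulrA IH expr2 e; ring.
Qed.

End Descent.

(** * Exactness of the arguments and the five congruences *)

Lemma Bz_mod0 l r (m : int) : (forall k, m = Posz k -> (l %| B l r k)%N) ->
  Bz l r m = 0%N %[mod l].
Proof.
by case: m => [k /(_ k erefl) /eqP h|k _] //=; rewrite h mod0n.
Qed.

Local Close Scope ring_scope.

Theorem corollary1p2 (n t p : nat) (j : int)
    (hp : prime p) (hj : ~~ (p%:Z %| j)%Z) :
  [/\ (p = 2 %[mod 3] ->
        Bz 3 12 (3 * p%:Z ^+ (2 * t + 2) * n%:Z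
                 + (p%:Z ^+ (2 * t + 1) * (p%:Z + 3 * j) - 1))%R
          = 0 %[mod 3]),
      (p <> 3 -> p = 3 %[mod 4] ->
        Bz 3 15 (3 * p%:Z ^+ (2 * t + 2) * n%:Z
                 + ((p%:Z ^+ (2 * t + 1) * (5 * p%:Z + 12 * j) - 5) %/ 4)%Z)%R
          = 0 %[mod 3]),
      (p <> 5 -> p = 2 %[mod 3] ->
        Bz 5 10 (5 * p%:Z ^+ (2 * t + 2) * n%:Z
                 + ((5 * (p%:Z ^+ (2 * t + 1) * (p%:Z + 3 * j) - 1)) %/ 3)%Z)%R
          = 0 %[mod 5]),
      (p <> 7 -> p = 3 %[mod 4] ->
        Bz 7 7 (7 * p%:Z ^+ (2 * t + 2) * n%:Z
                + ((7 * (p%:Z ^+ (2 * t + 1) * (p%:Z + 4 * j) - 1)) %/ 4)%Z)%R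
          = 0 %[mod 7])
    & (p <> 3 -> p <> 11 -> p = 3 %[mod 4] ->
        Bz 11 11 (11 * p%:Z ^+ (2 * t + 2) * n%:Z
                  + ((11 * (p%:Z ^+ (2 * t + 1) * (5 * p%:Z + 12 * j) - 5)) %/ 12)%Z)%R
          = 0 %[mod 11])].
Proof.
have p0 := prime_gt0 hp.
rewrite (_ : (p%:Z ^+ (2 * t + 2) = p%:Z ^+ (2 * t + 1) * p%:Z)%R); last first.
  by rewrite addn2 addn1 exprSr.
have coef24 : p <> 3 -> p = 3 %[mod 4] -> ~~ (p %| 24).
  move=> p3 p4; apply/negP => p24.
  have : p \in primes 24 by rewrite mem_primes hp.
  by rewrite !inE => /orP[] /eqP pE; rewrite pE // in p3 p4.
have mod4 : p = 3 %[mod 4] -> exists w,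
    (p%:Z ^+ (2 * t + 1) * p%:Z = 4 * w + 1)%R.
  move=> p4; have e : (p%:Z = 4 * (p %/ 4)%:Z + 3)%R by lia.
  apply: (@sqr_pow_mod _ 4 (4 * (p %/ 4)%:Z ^+ 2 + 6 * (p %/ 4)%:Z + 2)%R).
  by rewrite e; ring.
have mod3 : p = 2 %[mod 3] -> exists w,
    (p%:Z ^+ (2 * t + 1) * p%:Z = 3 * w + 1)%R.
  move=> p3; have e : (p%:Z = 3 * (p %/ 3)%:Z + 2)%R by lia.
  apply: (@sqr_pow_mod _ 3 (3 * (p %/ 3)%:Z ^+ 2 + 4 * (p %/ 3)%:Z + 1)%R).
  by rewrite e; ring.
have mod12 : p <> 3 -> p = 3 %[mod 4] -> exists w,
    (p%:Z ^+ (2 * t + 1) * p%:Z = 12 * w + 1)%R.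
  move=> p3 p4; have p3' : p %% 3 != 0.
    by apply/negP => h; apply/p3/esym/eqP; rewrite -dvdn_prime2.
  (* A number congruent to 3 modulo 4 is 3, 7 or 11 modulo 12, and 3 is excluded as p is prime to
     3. *)
  have [e|e] : (p%:Z = 12 * (p %/ 12)%:Z + 7)%R \/ (p%:Z = 12 * (p %/ 12)%:Z + 11)%R.
    lia.
    apply: (@sqr_pow_mod _ 12 (12 * (p %/ 12)%:Z ^+ 2 + 14 * (p %/ 12)%:Z + 4)%R).
    by rewrite e; ring.
  apply: (@sqr_pow_mod _ 12 (12 * (p %/ 12)%:Z ^+ 2 + 22 * (p %/ 12)%:Z + 10)%R).
  by rewrite e; ring.
have gauss (x y u : int) : p = 3 %[mod 4] ->
    (x * x + y * y = p%:Z ^+ (2 * t + 1) * u)%R -> (p %| u)%Z.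
  move=> p4; apply: (@odd_valuation _ hp (fun x y => x * x + y * y)%R).
    by move=> {}x {}y; apply: dvdz_sum_sqr.
  by move=> *; ring.
have eisen (x y u : int) : p = 2 %[mod 3] ->
    (x * x - x * y + y * y = p%:Z ^+ (2 * t + 1) * u)%R -> (p %| u)%Z.
  move=> p3; apply: (@odd_valuation _ hp (fun x y => x * x - x * y + y * y)%R).
    by move=> {}x {}y; apply: dvdz_norm3.
  by move=> *; ring.
(* Only the facts just proved about the odd power of p are used below, so it is replaced by a
   variable [P]. *)
move: (p%:Z ^+ (2 * t + 1) : int)%R mod3 mod4 mod12 gauss eisen.
move=> P mod3 mod4 mod12 gauss eisen.
split.
(* Here (l-1)k = 8. If m = 3N then 3N+1 = P((3n+1)p + 3j), so p would divide 3. *)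
- move=> p3; apply: Bz_mod0 => m em; apply: (@B_mod 3 4 m (24 * m + 25)) => //; first lia.
  move=> N mN; apply/eqP; apply: contraT => /euler8_support [|x [y exy]]; first lia.
  have /(dvdz_coef hp hj) : (p %| ((3 * n%:Z + 1) * p%:Z + 3%:Z * j)%R)%Z.
    apply: (eisen x y) => //; rewrite -exy; lia.
  by rewrite dvdn_prime2 // => /eqP pE; rewrite pE in p3.
(* Here (l-1)k = 10. If m = 3N then 24N+10 = P((24n+10)p + 24j), so p would divide 24. *)
- move=> p3 p4; have [w ew] := mod4 p4.
  rewrite (_ : (P * (5 * p%:Z + 12 * j) - 5 = (5 * w + 3 * (P * j)) * 4)%R); last by lia.
  rewrite mulzK //; apply: Bz_mod0 => m em.
  apply: (@B_mod 3 5 m (24 * m + 25)) => //; first lia.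
  move=> N mN; apply/eqP; apply: contraT => /euler10_support [|x [y exy]]; first lia.
  have /(dvdz_coef hp hj) : (p %| ((24 * n%:Z + 10) * p%:Z + 24%:Z * j)%R)%Z.
    apply: (gauss x y) => //; rewrite -exy; lia.
  by rewrite (negbTE (coef24 p3 p4)).
(* Again (l-1)k = 8, now with m = 5N, and 3N+1 is the same expression as in the first case. *)
- move=> _ p3; have [w ew] := mod3 p3.
  rewrite (_ : (5 * (P * (p%:Z + 3 * j) - 1) = (5 * (w + P * j)) * 3)%R); last by lia.
  rewrite mulzK //; apply: Bz_mod0 => m em.
  apply: (@B_mod 5 2 m (24 * m + 25)) => //; first lia.
  move=> N mN; apply/eqP; apply: contraT => /euler8_support [|x [y exy]]; first lia.
  have /(dvdz_coef hp hj) : (p %| ((3 * n%:Z + 1) * p%:Z + 3%:Z * j)%R)%Z.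
    apply: (eisen x y) => //; rewrite -exy; lia.
  by rewrite dvdn_prime2 // => /eqP pE; rewrite pE in p3.
(* Here (l-1)k = 6. If m = 7N then 8N+2 = P((8n+2)p + 8j), so p would divide 8. *)
- move=> _ p4; have [w ew] := mod4 p4.
  rewrite (_ : (7 * (P * (p%:Z + 4 * j) - 1) = (7 * (w + P * j)) * 4)%R); last by lia.
  rewrite mulzK //; apply: Bz_mod0 => m em.
  apply: (@B_mod 7 1 m (24 * m + 25)) => //; first lia.
  move=> N mN; apply/eqP; apply: contraT => /euler6_support [|x [y exy]]; first lia.
  have /(dvdz_coef hp hj) : (p %| ((8 * n%:Z + 2) * p%:Z + 8%:Z * j)%R)%Z.
    apply: (gauss x y) => //; rewrite -exy; lia.
  move=> p8; have : p \in primes 8 by rewrite mem_primes hp.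
  by rewrite inE => /eqP pE; rewrite pE in p4.
(* Again (l-1)k = 10, now with m = 11N, and 24N+10 is the same expression as in the second case. *)
- move=> p3 _ p4; have [w ew] := mod12 p3 p4.
  rewrite (_ : (11 * (P * (5 * p%:Z + 12 * j) - 5) =
    (11 * (5 * w + P * j)) * 12)%R); last by lia.
  rewrite mulzK //; apply: Bz_mod0 => m em.
  apply: (@B_mod 11 1 m (24 * m + 25)) => //; first lia.
  move=> N mN; apply/eqP; apply: contraT => /euler10_support [|x [y exy]]; first lia.
  have /(dvdz_coef hp hj) : (p %| ((24 * n%:Z + 10) * p%:Z + 24%:Z * j)%R)%Z.
    apply: (gauss x y) => //; rewrite -exy; lia.
  by rewrite (negbTE (coef24 p3 p4)).
Qed.
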